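(* Let $X=\mu_X+\lambda^{-1}\xi$, where $\xi\sim\mathcal N(0,\Sigma_X)$, and let $Y=f(X)$. Assume that $f:\mathbb R^n\to\mathbb R^d$ has bounded derivatives of orders $1,\ldots,4$. Let $\gamma_Y\sim\mathcal N(\mathbb E Y,\operatorname{Cov}Y)$ be the moment-matched Gaussian. Then $$d_4(Y,\gamma_Y)=O(\lambda^{-4})\qquad(\lambda\to\infty).$$ By contrast, the linearized Gaussian $G_{\mathrm{lin}}$ generically has $O(\lambda^{-2})$ error in the same smooth distance $d_4$, because it misses the second-order mean correction.
   Context: Here $\mu_X\in\mathbb R^n$ and the covariance matrix $\Sigma_X\in\mathbb R^{n\times n}$ are fixed, and $\lambda>0$ is a scale parameter (large $\lambda$ is the low-variance regime). For $h:\mathbb R^d\to\mathbb R$ define the homogeneous Sobolev seminorm $\|h\|_{\dot W^{4,\infty}}:=\max_{1\le j\le 4}\sup_{x\in\mathbb R^d}\|D^jh(x)\|_{\mathrm{op}}$, where $D^jh(x)$ is the $j$-th derivative viewed as a $j$-linear form and $\|\cdot\|_{\mathrm{op}}$ is its operator norm. For random variables $U,V$ with values in $\mathbb R^d$, the fourth-order smooth distance is $$d_4(U,V):=\sup_{\|h\|_{\dot W^{4,\infty}}\le 1}\big|\mathbb E h(U)-\mathbb E h(V)\big|.$$ The linearized Gaussian is $G_{\mathrm{lin}}\sim\mathcal N\big(f(\mu_X),\lambda^{-2}J\Sigma_XJ^{\top}\big)$, where $J$ is the $d\times n$ Jacobian matrix of $f$ at $\mu_X$. The second-order mean correction is the term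 $\lambda^{-2}\,\mathbb E\big[\tfrac12 D^2f(\mu_X)[\xi,\xi]\big]$ in the expansion of $\mathbb E Y$ about $f(\mu_X)$. The word ''generically'' is informal in the source and is not given a precise condition in the theorem. *)

(* Defs.v *)
From HB Require Import structures.
From mathcomp Require Import all_boot all_order all_algebra.
From mathcomp Require Import all_classical all_reals all_analysis.

Set Implicit Arguments.
Unset Strict Implicit.
Unset Printing Implicit Defensive.

Import Order.TTheory GRing.Theory Num.Theory.
Import numFieldNormedType.Exports.

Local Open Scope classical_set_scope.
Local Open Scope ring_scope.

(* Vectors are row vectors. The library norm of 'rV[R]_n is the sup norm, so the
   Euclidean norm, which the operator norms below refer to, is defined here. *)
Definition enorm (R : realType) (n : nat) (v : 'rV[R]_n) : R :=
  Num.sqrt (\sum_(i < n) v 0 i ^+ 2).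

(* k-fold Frechet differentiability on the whole space. On a finite-dimensional
   V the map x |-> Df(x) is differentiable iff x |-> Df(x)[v] is so for each v,
   which gives the recursion. *)
Fixpoint times_differentiable (R : realType) (V W : normedModType R)
    (k : nat) (f : V -> W) : Prop :=
  if k is k'.+1 then
    (forall x, differentiable f x) /\
    (forall v, times_differentiable k' ('D_v f))
  else True.

(* D^j f(x)[v_1, ..., v_j] for [:: v_1; ...; v_j], as an iterated directional
   derivative; it is the j-th Frechet derivative when f is j times
   differentiable in the above sense, the only case in which it is used. *)
Definition nderive (R : realType) (V W : normedModType R) (f : V -> W)
    (vs : seq V) : V -> W :=
  foldr (fun v g => 'D_v g) f vs.

(* N is the norm of the codomain W. *)
Definition opnorm (R : realType) (n : nat) (W : Type) (N : W -> R) (j : nat)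
    (A : j.-tuple 'rV[R]_n -> W) : \bar R :=
  ereal_sup [set (N (A v))%:E |
    v in [set v : j.-tuple 'rV[R]_n | forall i, enorm (tnth v i) <= 1]].

Definition sup_deriv_norm (R : realType) (n : nat) (W : normedModType R)
    (N : W -> R) (j : nat) (f : 'rV[R]_n -> W) : \bar R :=
  ereal_sup [set opnorm N (fun v : j.-tuple 'rV[R]_n => nderive f v x) |
    x in [set: 'rV[R]_n]].

Definition sobolev4 (R : realType) (d : nat) (h : 'rV[R]_d -> R) : \bar R :=
  (\big[maxe/0]_(1 <= j < 5) sup_deriv_norm (fun r : R => `|r|%R) j h)%E.

(* U and V may live on different probability spaces. *)
Definition d4 (R : realType) (d : nat)
    (dU : measure_display) (TU : measurableType dU) (PU : probability TU R)
    (U : TU -> 'rV[R]_d)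
    (dV : measure_display) (TV : measurableType dV) (PV : probability TV R)
    (V : TV -> 'rV[R]_d) : \bar R :=
  ereal_sup [set (`| 'E_PU[h \o U] - 'E_PV[h \o V] |)%E |
    h in [set h : 'rV[R]_d -> R |
            times_differentiable 4 h /\ (sobolev4 h <= 1)%E]].

Definition mean_vec (R : realType) (d : nat)
    (dT : measure_display) (T : measurableType dT) (P : probability T R)
    (Z : T -> 'rV[R]_d) : 'rV[R]_d :=
  \row_(i < d) fine ('E_P[fun w => (Z w 0 i)%R])%E.

Definition cov_mx (R : realType) (d : nat)
    (dT : measure_display) (T : measurableType dT) (P : probability T R)
    (Z : T -> 'rV[R]_d) : 'M[R]_d :=
  \matrix_(i < d, j < d)
    fine (covariance P (fun w => Z w 0 i) (fun w => Z w 0 j)).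

(* The law N(m, v) on the line. The case v = 0 is separate because normal_prob,
   whose second argument is the standard deviation, is not a Dirac mass when it
   is 0. *)
Definition normal_law (R : realType) (m v : R)
    (A : set (measurableTypeR R)) : \bar R :=
  if v == 0 then dirac (m : measurableTypeR R) A
  else normal_prob m (Num.sqrt v) A.

(* Z ~ N(m, S), S possibly singular: every linear combination <u, Z> of the
   coordinates of Z has law N(<u, m>, u S u^T). The first two clauses say that S
   is a covariance matrix; the marginals alone do not determine a nonsymmetric S,
   and Num.sqrt is 0 on negative numbers. *)
Definition gaussian_vector (R : realType) (n : nat)
    (dT : measure_display) (T : measurableType dT) (P : probability T R)
    (Z : T -> 'rV[R]_n) (m : 'rV[R]_n) (S : 'M[R]_n) : Prop :=
  [/\ S^T = S,
      forall u : 'rV[R]_n, 0 <= (u *m S *m u^T) 0 0,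
      forall i : 'I_n, measurable_fun [set: T] (fun w => Z w 0 i) &
      forall (u : 'rV[R]_n) (A : set (measurableTypeR R)), measurable A ->
        pushforward P (fun w => (Z w *m u^T) 0 0 : measurableTypeR R) A =
        normal_law ((m *m u^T) 0 0) ((u *m S *m u^T) 0 0) A].

(* The d x n Jacobian matrix; the library's 'J f x acts on row vectors on the
   right and is n x d. *)
Definition Jac (R : realType) (n d : nat) (f : 'rV[R]_n -> 'rV[R]_d)
    (x : 'rV[R]_n) : 'M[R]_(d, n) := (jacobian f x)^T.

(* Main.v *)
(** Write [e = l^-1]. A test function [h] with derivatives up to order 4 bounded
    by 1 is expanded at a point [m] up to order [k <= 4], so that
    [|E h(U) - E h(V)|] is at most [E |U - m|^k + E |V - m|^k] plus the
    differences of the moments of [U - m] and [V - m] of order less than [k].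
    For the moment-matched Gaussian take [k = 4] and [m = E Y]: the moments of
    order 1 and 2 agree, those of order 3 are [0] for the Gaussian and
    [O(e^4)] for [Y], because the leading term [e^3 E (J xi)^3] of the latter is
    an odd Gaussian moment. For the linearized Gaussian take [k = 2] and
    [m = f mu], where the means differ by [e^2 b + O(e^3)]; the coordinate
    functions are admissible test functions, which gives the lower bound.

    The Gaussian moments are read off the moment generating function
    [E exp(t y) = exp(t^2 v / 2)] by comparing Taylor expansions at [t = 0]; it
    determines them without any change of variables, and polarization passes
    from linear forms to products of coordinates. *)
Require Import Defs.
From HB Require Import structures.
From mathcomp Require Import all_boot all_order all_algebra.
From mathcomp Require Import all_classical all_reals all_analysis.
From mathcomp Require Import measurable_realfun ring lra.

Set Implicit Arguments.
Unset Strict Implicit.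
Unset Printing Implicit Defensive.

Import Order.TTheory GRing.Theory Num.Theory.
Import numFieldNormedType.Exports.

Local Open Scope classical_set_scope.
Local Open Scope ring_scope.

(** * Taylor's formula in one and in several variables *)

(** Induction on [k], with one use of the mean value theorem per step: the derivative of the
    remainder is the remainder of the shifted family [fun i => phi i.+1]. The factor [t <= 1] that
    appears is dropped, so the bound is [M] without the usual factorial. *)
Lemma taylor_bound (R : realType) (k : nat) (phi : nat -> R -> R) (M : R) :
  (forall i (t : R), (i < k)%N -> is_derive t 1 (phi i) (phi i.+1 t)) ->
  (forall t : R, 0 <= t <= 1 -> `|phi k t| <= M) ->
  forall t : R, 0 <= t <= 1 ->
  `|phi 0%N t - \sum_(i < k) phi i 0 / i`!%:R * t ^+ i| <= M.
Proof.
elim: k phi => [|k IHk] phi dphi phik t t01.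
  by rewrite big_ord0 subr0 phik.
pose q (s : R) := \sum_(i < k.+1) phi i 0 / i`!%:R * s ^+ i.
pose dq (s : R) := \sum_(i < k) phi i.+1 0 / i`!%:R * s ^+ i.
have dqE (s : R) : is_derive s 1 q (dq s).
  have -> : q = \sum_(i < k.+1) (phi i 0 / i`!%:R) \*: (@id R ^+ i).
    by apply/funext => y; rewrite fct_sumE; apply: eq_bigr => i _; rewrite /= exprfctE.
  apply: is_derive_eq; rewrite big_ord_recl /= mul0r scale0r scaler0 add0r.
  apply: eq_bigr => i _; rewrite /bump /= add1n add0n factS natrM.
  have := fact_gt0 i; rewrite -(ltr_nat R) => i0.
  have j0 : (i.+1%:R : R) != 0 by rewrite pnatr_eq0.
  rewrite /GRing.scale /= mulr1.
  field.
  by rewrite ?nat1r ?natr1 j0 gt_eqF.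
have dpsi (s : R) : is_derive s 1 (phi 0%N - q) (phi 1%N s - dq s).
  by apply: is_deriveB; exact: dphi.
have [t0 t1] := andP t01.
have [|c ct] := MVT_segment t0 (fun x _ => dpsi x).
  apply: derivable_within_continuous => x _.
  exact: ex_derive.
have -> : (phi 0%N - q) 0 = 0.
  rewrite /GRing.add /GRing.opp /= /q big_ord_recl /= big1 => [|i _].
    by rewrite fact0 divr1 mulr1 addr0 subrr.
  by rewrite expr0n mulr0.
have -> : (phi 0%N - q) t = phi 0%N t - q t by [].
rewrite !subr0 => ->.
have c01 : 0 <= c <= 1.
  by move: ct; rewrite in_itv /= => /andP[-> /le_trans ->].
have := IHk (fun i => phi i.+1) (fun i t ik => dphi i.+1 t ik) phik c c01.
rewrite -/(dq c) normrM (ger0_norm t0) => B.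
rewrite (le_trans _ B)// ler_piMr//.
Qed.

Section words.
Variable n : nat.

(** Ordered words of indices rather than multi-indices: [D^k g(x)[z, ..., z]] is then a plain sum
    over words, free of multinomial coefficients. *)
Fixpoint words (k : nat) : seq (seq 'I_n) :=
  if k is k'.+1 then [seq i :: J | i <- enum 'I_n, J <- words k'] else [:: [::]].

Lemma size_words k J : J \in words k -> size J = k.
Proof.
elim: k J => [|k IHk] J /=; first by rewrite inE => /eqP ->.
by move=> /allpairsP[[i J']] /= [_ /IHk <- ->].
Qed.

End words.

Definition basis_vec (R : realType) (n : nat) (i : 'I_n) : 'rV[R]_n :=
  delta_mx 0 i.
Definition partial (R : realType) (n : nat) (g : 'rV[R]_n -> R) (J : seq 'I_n) :=
  nderive g [seq basis_vec R i | i <- J].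
Definition monom (R : realType) (n : nat) (z : 'rV[R]_n) (J : seq 'I_n) : R :=
  \prod_(i <- J) z 0 i.
(** For this norm the absolute values of the monomials of degree [k] sum exactly to a [k]-th power
    ([norm_monom_words]), so Taylor remainders carry no dimensional constant. *)
Definition l1norm (R : realType) (n : nat) (z : 'rV[R]_n) : R :=
  \sum_i `|z 0 i|.

Section deriv.
Variables (R : realType) (n : nat).
Implicit Types (g : 'rV[R]_n -> R) (x z : 'rV[R]_n).

(** Induction from the right: the last vector of [vs] is the direction of the derivative taken
    first, the one that [times_differentiable] peels off. *)
Lemma nderive_differentiable (V W : normedModType R) (k : nat) (f : V -> W)
    (vs : seq V) :
  times_differentiable k f -> (size vs < k)%N ->
  forall x : V, differentiable (nderive f vs) x.
Proof.
elim/last_ind: vs k f => [|vs v IH] [|k] f //= [df ddf] // vsk x.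
by rewrite /nderive foldr_rcons; apply: (IH k) => //; move: vsk; rewrite size_rcons.
Qed.

Lemma derive_basis g x z : differentiable g x ->
  'D_z g x = \sum_i z 0 i * 'D_(basis_vec R i) g x.
Proof.
move=> dg; rewrite deriveE// {1}[z]row_sum_delta linear_sum.
by apply: eq_bigr => i _; rewrite linearZ deriveE.
Qed.

Lemma nderive_words g k z x :
  (forall J y, (size J < k)%N -> differentiable (partial g J) y) ->
  nderive g (nseq k z) x = \sum_(J <- words n k) monom z J * partial g J x.
Proof.
elim: k x => [|k IHk] x dg /=.
  by rewrite big_seq1 /monom big_nil mul1r.
(* The induction hypothesis is restated as an identity of functions, with a sum over ordinals, so
   that it can be differentiated term by term. *)
have {}IHk : nderive g (nseq k z) =
    \sum_(i < size (words n k)) (monom z (nth [::] (words n k) i) \*: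
      partial g (nth [::] (words n k) i)).
  apply/funext => y; rewrite fct_sumE IHk => [|J u Ik]; last exact/dg/ltnW.
  by rewrite (big_nth [::]) big_mkord; apply: eq_bigr.
have dI (i : 'I_(size (words n k))) y :
    differentiable (partial g (nth [::] (words n k) i)) y.
  by apply: dg; rewrite (@size_words _ k) ?mem_nth.
rewrite IHk derive_sum => [|i]; last first.
  by apply: diff_derivable; apply: differentiableZ; exact: dI.
rewrite big_allpairs_dep exchange_big /= [in RHS](big_nth [::]) big_mkord.
apply: eq_bigr => i _; rewrite deriveZ; last exact: diff_derivable.
rewrite derive_basis// /GRing.scale/= big_distrr /= big_enum /=.
apply: eq_bigr => j _.
by rewrite /monom big_cons mulrCA !mulrA.
Qed.

Lemma norm_monom_words z k :
  \sum_(J <- words n k) `|monom z J| = l1norm z ^+ k.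
Proof.
elim: k => [|k IHk]; first by rewrite /= big_seq1 /monom big_nil normr1 expr0.
rewrite /= big_allpairs_dep exprS -IHk /l1norm big_distrl /= big_enum /=.
apply: eq_bigr => i _; rewrite big_distrr /=; apply: eq_bigr => J _.
by rewrite /monom big_cons normrM.
Qed.

(** This is [taylor_bound] at [t = 1] for the restriction of [g] to the line through [x] and
    [x + z], whose [i]-th derivative is [D^i g] applied to [i] copies of [z]. *)
Lemma taylor_rV g k (M : R) x z :
  (forall J y, (size J < k)%N -> differentiable (partial g J) y) ->
  (forall J y, size J = k -> `|partial g J y| <= M) ->
  `|g (x + z) - \sum_(i < k) (i`!%:R)^-1 * nderive g (nseq i z) x|
    <= M * l1norm z ^+ k.
Proof.
move=> dg Mg.
pose phi i (t : R) := nderive g (nseq i z) (x + t *: z).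
have dnd i y : (i < k)%N -> differentiable (nderive g (nseq i z)) y.
  move=> ik; have -> : nderive g (nseq i z) =
      \sum_(j < size (words n i)) (monom z (nth [::] (words n i) j) \*:
      partial g (nth [::] (words n i) j)).
    apply/funext => u; rewrite fct_sumE nderive_words => [|J v Ii].
      by rewrite (big_nth [::]) big_mkord; apply: eq_bigr.
    by apply: dg; exact: ltn_trans ik.
  apply: differentiable_sum => j; apply: differentiableZ; apply: dg.
  by rewrite (@size_words _ i) ?mem_nth.
have dphi i (t : R) : (i < k)%N -> is_derive t 1 (phi i) (phi i.+1 t).
  move=> ik; have := diff_derivable (v := z) (dnd i (x + t *: z) ik).
  (* Difference quotients of [phi i] at [t] are those of [D^i g[z, ..., z]] at [x + t *: z] in the
     direction [z]. *)
  have E : (fun h : R => h^-1 *: ((phi i \o shift t) (h *: 1) - phi i t)) =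
      (fun h : R => h^-1 *: ((nderive g (nseq i z) \o shift (x + t *: z)) (h *: z)
        - nderive g (nseq i z) (x + t *: z))).
    apply/funext => h; rewrite /phi /=; congr (_ *: (nderive _ _ _ - _)).
    by rewrite [h *: 1]mulr1 scalerDl addrCA.
  by move=> dz; apply: DeriveDef; rewrite /derivable /derive E.
have phik t : 0 <= t <= 1 -> `|phi k t| <= M * l1norm z ^+ k.
  move=> _; rewrite /phi nderive_words// (le_trans (ler_norm_sum _ _ _))//.
  rewrite -norm_monom_words mulrC big_distrl /= big_seq [leRHS]big_seq ler_sum// => J Ik.
  by rewrite normrM ler_wpM2l// Mg// (size_words Ik).
have := taylor_bound dphi phik (t := 1); rewrite ler01 lexx => /(_ isT).
rewrite /phi scale1r; under eq_bigr do
  rewrite expr1n mulr1 scale0r addr0 mulrC.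
by [].
Qed.

End deriv.

(** * Integrability and integrals of real-valued functions *)

Local Notation L1 P f := (integrable P setT (EFin \o f)).

Section expectation.
Context (R : realType) (dT : measure_display) (T : measurableType dT)
  (P : probability T R).
Implicit Types (f g : T -> R).

Lemma L1_measurable f : L1 P f -> measurable_fun setT f.
Proof. by case/integrableP => /measurable_EFinP. Qed.

Lemma L1_le f g : measurable_fun setT f -> L1 P g ->
  (forall w, `|f w| <= g w) -> L1 P f.
Proof.
move=> mf ig fg; apply: le_integrable ig => //; first exact/measurable_EFinP.
by move=> w _ /=; rewrite lee_fin (le_trans (fg w))// ler_norm.
Qed.

Lemma L1_cst r : L1 P (fun=> r).
Proof. exact: finite_measure_integrable_cst. Qed.

Lemma L1D f g : L1 P f -> L1 P g -> L1 P (fun w => f w + g w).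
Proof. exact: integrableD. Qed.

Lemma L1B f g : L1 P f -> L1 P g -> L1 P (fun w => f w - g w).
Proof. exact: integrableB. Qed.

Lemma L1Z r f : L1 P f -> L1 P (fun w => r * f w).
Proof. exact: integrableZl. Qed.

Lemma L1_sum (J : Type) (s : seq J) (F : J -> T -> R) :
  (forall j, L1 P (F j)) -> L1 P (fun w => \sum_(j <- s) F j w).
Proof.
move=> LF; elim: s => [|j s IH].
  by under eq_fun do rewrite big_nil; exact: L1_cst.
by under eq_fun do rewrite big_cons; exact: L1D.
Qed.

Lemma Rint_sum (J : Type) (s : seq J) (F : J -> T -> R) :
  (forall j, L1 P (F j)) ->
  \int[P]_w (\sum_(j <- s) F j w) = \sum_(j <- s) \int[P]_w (F j w).
Proof.
move=> LF; elim: s => [|j s IH].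
  by under eq_Rintegral do rewrite big_nil; rewrite Rintegral_cst// mul0r big_nil.
under eq_Rintegral do rewrite big_cons.
by rewrite RintegralD// ?IH ?big_cons//; exact: L1_sum.
Qed.

Lemma Rint_cst r : \int[P]_w r = r.
Proof. by rewrite Rintegral_cst//= [P _]probability_setT mulr1. Qed.

Lemma le_Rint f g : L1 P f -> L1 P g -> (forall w, f w <= g w) ->
  \int[P]_w f w <= \int[P]_w g w.
Proof. by move=> Lf Lg fg; apply: le_Rintegral. Qed.

Lemma norm_Rint_le f g : L1 P f -> L1 P g -> (forall w, `|f w| <= g w) ->
  `|\int[P]_w f w| <= \int[P]_w g w.
Proof.
move=> Lf Lg fg; apply: (le_trans (le_normr_Rintegral _ _)) => //.
by apply: le_Rint => //; exact: integrable_norm.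
Qed.

End expectation.

(** * Moment generating function of a Gaussian vector *)

Section normal_mgf.
Context (R : realType).
Local Notation leb := (@lebesgue_measure R).

(** The Radon-Nikodym derivative of [normal_prob m s] agrees almost everywhere with
    [normal_pdf m s], since both have the same integral over every measurable set. *)
Lemma ge0_integral_normal_prob (m s : R) (f : R -> \bar R) :
  (forall x, 0 <= f x)%E -> measurable_fun setT f ->
  (\int[normal_prob m s]_x f x = \int[leb]_x (f x * (normal_pdf m s x)%:E))%E.
Proof.
move=> f0 mf.
have dom := normal_prob_dominates m s.
rewrite -(Radon_Nikodym_SigmaFinite.change_of_variables dom)//.
have iRN := Radon_Nikodym_SigmaFinite.f_integrable dom.
have mpdf : measurable_fun setT (fun x => (normal_pdf m s x)%:E).
  by apply/measurable_EFinP; exact: measurable_normal_pdf.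
apply: ae_eq_integral => //.
- by apply: emeasurable_funM => //; exact: measurable_int iRN.
- exact: emeasurable_funM.
apply: ae_eqe_mul2l; apply: integral_ae_eq => //= E _ mE.
by rewrite -Radon_Nikodym_SigmaFinite.f_integral.
Qed.

(* Completing the square turns [expR (t * (x - m)) * normal_pdf m s x] into a
   multiple of the density of mean [m + t * s ^+ 2], whose total mass is 1. *)
Lemma normal_prob_mgf (m s t : R) : s != 0 ->
  (\int[normal_prob m s]_x (expR (t * (x - m)))%:E
    = (expR (t ^+ 2 / 2 * s ^+ 2))%:E)%E.
Proof.
move=> s0; rewrite ge0_integral_normal_prob; last 2 first.
- by move=> x; rewrite lee_fin expR_ge0.
- apply/measurable_EFinP/measurableT_comp; first exact: measurable_expR.
  by apply: measurable_funM => //; exact: measurable_funB.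
transitivity (\int[leb]_x ((expR (t ^+ 2 / 2 * s ^+ 2))%:E *
    (normal_pdf (m + t * s ^+ 2) s x)%:E))%E.
  apply: eq_integral => x _; rewrite -!EFinM !normal_pdfE// /normal_fun.
  congr EFin; rewrite mulrCA [in RHS]mulrCA -!expRD; congr (_ * expR _).
  have : s ^+ 2 != 0 by rewrite expf_neq0.
  rewrite opprD addrA; move: (s ^+ 2) (x - m) => q y q0.
  by rewrite -[q *+ 2]mulr_natr; field; exact: q0.
rewrite ge0_integralZl//=; last 2 first.
- by apply/measurable_EFinP; exact: measurable_normal_pdf.
- by move=> x _; rewrite lee_fin normal_pdf_ge0.
by rewrite integral_normal_pdf mule1.
Qed.

(** Only the law of the linear form [<u, Z>] matters: the integral is transported to the line, where
    that law is explicit. *)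
Lemma gaussian_mgf (n : nat) (dT : measure_display) (T : measurableType dT)
    (P : probability T R) (Z : T -> 'rV[R]_n) (m : 'rV[R]_n) (S : 'M[R]_n)
    (u : 'rV[R]_n) (t : R) :
  gaussian_vector P Z m S ->
  (\int[P]_w (expR (t * ((Z w - m) *m u^T) 0 0))%:E
    = (expR (t ^+ 2 / 2 * (u *m S *m u^T) 0 0))%:E)%E.
Proof.
move=> [_ S0 mZ law]; set v := (u *m S *m u^T) 0 0; set c := (m *m u^T) 0 0.
pose X w : measurableTypeR R := (Z w *m u^T) 0 0.
have mX : measurable_fun setT X.
  rewrite /X; under eq_fun do rewrite mxE; apply: measurable_sum => i.
  by apply: measurable_funM => //; exact: mZ.
pose g (x : measurableTypeR R) := (expR (t * (x - c)))%:E.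
have mg : measurable_fun setT g.
  apply/measurable_EFinP/measurableT_comp; first exact: measurable_expR.
  by apply: measurable_funM => //; exact: measurable_funB.
have -> : (\int[P]_w (expR (t * ((Z w - m) *m u^T) 0 0))%:E =
    \int[pushforward P X]_x g x)%E.
  rewrite ge0_integral_pushforward//.
    by apply: eq_integral => w _; rewrite mulmxBl mxE [X in _ + X]mxE.
  by move=> x _; rewrite /g lee_fin expR_ge0.
have lawX A : measurable A -> pushforward P X A = normal_law c v A.
  by move=> mA; exact: law.
rewrite /normal_law in lawX.
have v0 : 0 <= v by exact: S0.
(* In the degenerate case [v = 0] the law is the Dirac mass at [c], and both sides equal 1. *)
move: lawX; case: eqVneq => [v00|vN0] lawX.
  rewrite (eq_measure_integral (dirac (c : measurableTypeR R))).
    by rewrite integral_dirac// diracT mul1e /g subrr mulr0 v00 mulr0.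
  by move=> A mA _; exact: lawX.
have sv0 : Num.sqrt v != 0 by rewrite sqrtr_eq0 -ltNge lt_neqAle eq_sym vN0.
rewrite (eq_measure_integral (normal_prob c (Num.sqrt v))).
  by rewrite normal_prob_mgf// sqr_sqrtr.
by move=> A mA _; exact: lawX.
Qed.

End normal_mgf.

(** * Moments up to order four from the moment generating function *)

Lemma expR_taylor (R : realType) (k : nat) (x : R) :
  `|expR x - \sum_(i < k) x ^+ i / i`!%:R| <= `|x| ^+ k * expR `|x|.
Proof.
pose phi (i : nat) (t : R) := x ^+ i * expR (t * x).
have dphi i (t : R) : (i < k)%N -> is_derive t 1 (phi i) (phi i.+1 t).
  move=> _; rewrite /phi.
  have -> : (fun t => x ^+ i * expR (t * x)) = (x ^+ i) \*: (expR \o ( *%R^~ x)).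
    by [].
  apply: is_derive_eq => /=.
  by rewrite /GRing.scale /= exprS; ring.
have phik (t : R) : 0 <= t <= 1 -> `|phi k t| <= `|x| ^+ k * expR `|x|.
  move=> /andP[t0 t1]; rewrite normrM normrX ler_wpM2l ?exprn_ge0//.
  rewrite ger0_norm ?expR_ge0// ler_expR (le_trans (ler_norm _))//.
  by rewrite normrM (ger0_norm t0) ler_piMl.
have := taylor_bound dphi phik (t := 1); rewrite ler01 lexx => /(_ isT).
rewrite /phi mul1r expr0 mul1r; under eq_bigr do
  rewrite mul0r expR0 mulr1 expr1n mulr1.
by [].
Qed.

Lemma expR_normr_le (R : realType) (x : R) : expR `|x| <= expR x + expR (- x).
Proof.
by case: (ger0P x) => _; rewrite ?lerDl ?lerDr ?expR_ge0.
Qed.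

Lemma expr_even_normr (R : realType) (k : nat) (x : R) :
  ~~ odd k -> `|x| ^+ k = x ^+ k.
Proof. by move=> ke; rewrite -normrX ger0_norm// exprn_even_ge0. Qed.

(** The term of degree 4 of the exponential series is at most [expR |x|]. The symmetric right-hand
    side makes fourth moments accessible from the generating function at two opposite points. *)
Lemma expr4_le_expR (R : realType) (x : R) :
  x ^+ 4 <= 24 * (expR x + expR (- x)).
Proof.
have := expR_ge1Dxn 3 (normr_ge0 x); have := expR_normr_le x.
rewrite expr_even_normr// (_ : 4`! = 24)%N//.
by move: (x ^+ 4) (expR _) (expR _ + _) => a b c; lra.
Qed.

Lemma exprn_le_1Dexpr4 (R : realType) (k : nat) (x : R) :
  0 <= x -> (k <= 4)%N -> x ^+ k <= 1 + x ^+ 4.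
Proof.
move=> x0 k4; have [x1|/ltW x1] := leP x 1.
  by apply: (@le_trans _ _ 1); rewrite ?exprn_ile1// lerDl exprn_ge0.
by rewrite (le_trans (ler_weXn2l x1 k4))// lerDr.
Qed.

(** Coefficients are eliminated in increasing degree: after division by the lowest power of [t], the
    first one left is bounded by a multiple of [t], however small [t] is. *)
Lemma poly_near0_eq0 (R : realType) (a b c C : R) :
  (forall t, 0 < t <= 1 -> `|a * t + b * t ^+ 2 + c * t ^+ 3| <= C * t ^+ 4) ->
  [/\ a = 0, b = 0 & c = 0].
Proof.
have key (e D : R) : (forall t, 0 < t <= 1 -> `|e| <= D * t) -> e = 0.
  move=> eD; apply/eqP; rewrite -normr_le0 leNgt; apply/negP => e0.
  have D0 : 0 < D.
    by have := eD 1; rewrite ltr01 lexx mulr1 => /(_ isT); apply: lt_le_trans.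
  (* This choice makes [D * t] at most [|e| / 2], which is less than [|e|]. *)
  pose t := Num.min 1 (`|e| / (2 * D)).
  have t0 : 0 < t by rewrite lt_min ltr01 divr_gt0// mulr_gt0.
  have : t <= 1 by rewrite ge_min lexx.
  move=> t1; have := eD t; rewrite t0 t1 => /(_ isT).
  apply/negP; rewrite -ltNge.
  apply: (@le_lt_trans _ _ (D * (`|e| / (2 * D)))).
    by rewrite ler_pM2l// ge_min lexx orbT.
  have -> : D * (`|e| / (2 * D)) = `|e| / 2 by field; rewrite gt_eqF.
  by rewrite ltr_pdivrMr// ltr_pMr// ltr1n.
move=> H.
have C0 : 0 <= C.
  rewrite -[C]mulr1 -(expr1n R 4); apply: le_trans (normr_ge0 _) (H 1 _).
  by rewrite ltr01 lexx.
have a0 : a = 0.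
  apply: (key _ (C + `|b| + `|c|)) => t /andP[t0 t1].
  have := H t; rewrite t0 t1 => /(_ isT) Ht.
  rewrite -(ler_pM2r t0) -[X in `|_| * X](gtr0_norm t0) -normrM.
  have -> : a * t = (a * t + b * t ^+ 2 + c * t ^+ 3) - b * t ^+ 2 - c * t ^+ 3 by ring.
  rewrite (le_trans (ler_normB _ _))// (le_trans (lerD (ler_normB _ _) (lexx _)))//.
  rewrite (normrM b) (normrM c) !normrX (gtr0_norm t0).
  have t2 : t ^+ 4 <= t ^+ 2 by rewrite ler_wiXn2l// ltW.
  have t3 : t ^+ 3 <= t ^+ 2 by rewrite ler_wiXn2l// ltW.
  have := ler_wpM2l C0 t2; have := ler_wpM2l (normr_ge0 c) t3.
  move: Ht; lra.
have b0 : b = 0.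
  apply: (key _ (C + `|c|)) => t /andP[t0 t1].
  have := H t; rewrite t0 t1 a0 mul0r add0r => /(_ isT) Ht.
  have t20 : 0 < t ^+ 2 by rewrite exprn_gt0.
  rewrite -(ler_pM2r t20) -[X in `|_| * X](gtr0_norm t20) -normrM.
  have -> : b * t ^+ 2 = (b * t ^+ 2 + c * t ^+ 3) - c * t ^+ 3 by ring.
  rewrite (le_trans (ler_normB _ _))//.
  rewrite (normrM c) !normrX (gtr0_norm t0).
  have t3 : t ^+ 4 <= t ^+ 3 by rewrite ler_wiXn2l// ltW.
  have := ler_wpM2l C0 t3.
  move: Ht; rewrite !exprS; lra.
split=> //; apply: (key _ C) => t /andP[t0 t1].
have := H t; rewrite t0 t1 a0 b0 !mul0r !add0r => /(_ isT).
have t30 : 0 < t ^+ 3 by rewrite exprn_gt0.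
rewrite normrM (gtr0_norm t30) => Ht; rewrite -(ler_pM2r t30).
by have -> : C * t * t ^+ 3 = C * t ^+ 4 by ring.
Qed.

Section moments_of_mgf.
Context (R : realType) (dT : measure_display) (T : measurableType dT)
  (P : probability T R) (y : T -> R) (v : R).
Hypothesis my : measurable_fun setT y.
Hypothesis mgf : forall t,
  (\int[P]_w (expR (t * y w))%:E = (expR (t ^+ 2 / 2 * v))%:E)%E.

Let mexp t : measurable_fun setT (fun w => expR (t * y w)).
Proof.
by apply: measurableT_comp; [exact: measurable_expR|exact: measurable_funM].
Qed.

Let L1exp t : L1 P (fun w => expR (t * y w)).
Proof.
apply/integrableP; split; first exact/measurable_EFinP.
under eq_integral do rewrite /= ger0_norm ?expR_ge0//.
by rewrite mgf ltry.
Qed.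

Let Rmgf t : \int[P]_w expR (t * y w) = expR (t ^+ 2 / 2 * v).
Proof. by rewrite /Rintegral mgf. Qed.

Lemma mgf_L1_expr4 : L1 P (fun w => y w ^+ 4).
Proof.
apply: (@L1_le _ _ _ _ _ (fun w => 24 * (expR (1 * y w) + expR (-1 * y w)))).
- exact: measurable_funX.
- by apply: L1Z; exact: L1D.
- by move=> w; rewrite ger0_norm ?exprn_even_ge0// mul1r mulN1r expr4_le_expR.
Qed.

(** Scaling: [expr4_le_expR] is applied to [y / s], and the generating function at [1 / s] and
    [- 1 / s] is at most [expR 1]. A bound [v'] in place of [v] covers the degenerate case
    [v = 0]. *)
Lemma mgf_moment4 v' : 0 < v' -> v <= v' ->
  \int[P]_w (y w ^+ 4) <= 48 * expR 1 * v' ^+ 2.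
Proof.
move=> v'0 vv'; set s := Num.sqrt v'.
have s0 : 0 < s by rewrite sqrtr_gt0.
have s2 : s ^+ 2 = v' by rewrite sqr_sqrtr// ltW.
rewrite -s2 -exprM -ler_pdivrMr ?exprn_gt0// -RintegralZr//; last exact: mgf_L1_expr4.
apply: (@le_trans _ _ (\int[P]_w (24 * (expR (s^-1 * y w) + expR (- s^-1 * y w))))).
  apply: le_Rint.
  - by under eq_fun do rewrite mulrC; apply: L1Z; exact: mgf_L1_expr4.
  - by apply: L1Z; exact: L1D.
  - by move=> w; rewrite -exprVn -exprMn mulrC mulNr expr4_le_expR.
rewrite RintegralZl//; last exact: L1D.
rewrite RintegralD// !Rmgf sqrrN exprVn s2.
have : expR (v'^-1 / 2 * v) <= expR 1.
  rewrite ler_expR mulrAC -mulrA mulrC ler_pdivrMr// ler_pdivrMr// mul1r.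
  by rewrite (le_trans vv')// ler_peMr ?ler1n// ltW.
move: (expR _) (expR _) => a b; lra.
Qed.

Lemma mgf_L1_expr k : (k <= 4)%N -> L1 P (fun w => y w ^+ k).
Proof.
move=> k4; apply: (@L1_le _ _ _ _ _ (fun w => 1 + y w ^+ 4)).
- exact: measurable_funX.
- by apply: L1D; [exact: L1_cst|exact: mgf_L1_expr4].
by move=> w; rewrite normrX -expr_even_normr// exprn_le_1Dexpr4.
Qed.

(** The integrated expansion of [expR (t * y)] is compared with that of [expR (t ^+ 2 / 2 * v)].
    Both remainders are [O(t ^+ 4)], so the coefficients of degree 1, 2 and 3 agree. *)
Lemma mgf_moments : [/\ \int[P]_w y w = 0, \int[P]_w (y w ^+ 2) = v &
  \int[P]_w (y w ^+ 3) = 0].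
Proof.
have L1y : L1 P y by exact: (mgf_L1_expr (k := 1) isT).
pose m1 := \int[P]_w y w.
pose m2 := \int[P]_w (y w ^+ 2).
pose m3 := \int[P]_w (y w ^+ 3).
(* An integrable majorant that is uniform in [0 < t <= 1]: [y^4 * expR (t * |y|)] is at most
   [24 * (expR y + expR (- y))^2], which expands to [G]. *)
pose G w := 24 * (expR (2 * y w) + (2 + expR (-2 * y w))).
have LG : L1 P G by do ![exact: L1exp|exact: L1_cst|apply: L1Z|apply: L1D].
pose C := \int[P]_w G w + (v / 2) ^+ 2 * expR `|v / 2|.
suff [m10 /subr0_eq m2v m30] : [/\ m1 = 0, m2 / 2 - v / 2 = 0 & m3 / 6 = 0].
  split=> //; first by rewrite -/m2; move: m2v; lra.
  by rewrite -/m3; move: m30; lra.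
apply: (@poly_near0_eq0 _ _ _ _ C) => t /andP[t0 t1].
pose p w := \sum_(i < 4) (t * y w) ^+ i / i`!%:R.
have pE : p = fun w => (1 + t * y w) + (t ^+ 2 / 2 * y w ^+ 2 + t ^+ 3 / 6 * y w ^+ 3).
  apply/funext => w; rewrite /p !big_ord_recl big_ord0 /= /bump /=.
  by rewrite !factS fact0; field.
have L2 : L1 P (fun w => t ^+ 2 / 2 * y w ^+ 2) by apply: L1Z; exact: mgf_L1_expr.
have L3 : L1 P (fun w => t ^+ 3 / 6 * y w ^+ 3) by apply: L1Z; exact: mgf_L1_expr.
have L01 : L1 P (fun w => 1 + t * y w) by apply: L1D; [exact: L1_cst|exact: L1Z].
have L23 := L1D L2 L3.
have Lp : L1 P p by rewrite pE; exact: L1D.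
have Ip : \int[P]_w p w = 1 + t * m1 + t ^+ 2 / 2 * m2 + t ^+ 3 / 6 * m3.
  rewrite pE RintegralD// RintegralD//; [|exact: L1_cst|exact: L1Z].
  rewrite RintegralD// !RintegralZl//; [|exact: mgf_L1_expr|exact: mgf_L1_expr].
  by rewrite Rint_cst addrA.
have rG w : `|expR (t * y w) - p w| <= t ^+ 4 * G w.
  rewrite (le_trans (expR_taylor 4 _))// normrM exprMn gtr0_norm// -mulrA.
  rewrite ler_wpM2l ?exprn_ge0 ?(ltW t0)// expr_even_normr//.
  have e1 : expR (t * `|y w|) <= expR (y w) + expR (- y w).
    by rewrite (le_trans _ (expR_normr_le _))// ler_expR ler_piMl.
  apply: (@le_trans _ _ (24 * (expR (y w) + expR (- y w)) *
      (expR (y w) + expR (- y w)))).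
    rewrite ler_pM ?expR_ge0 ?exprn_even_ge0//; exact: expr4_le_expR.
  rewrite /G mulNr !expRN !expRM_natl.
  have := expR_gt0 (y w); move: (expR _) => e e0.
  rewrite le_eqVlt; apply/orP; left; apply/eqP; field.
  by rewrite gt_eqF.
have : `|\int[P]_w (expR (t * y w) - p w)| <= t ^+ 4 * \int[P]_w G w.
  rewrite -RintegralZl//; apply: norm_Rint_le => //; first exact: L1B.
  exact: L1Z.
rewrite RintegralB// Rmgf Ip => H1.
have := expR_taylor 2 (t ^+ 2 / 2 * v).
rewrite !big_ord_recl big_ord0 /= /bump /= => H2.
have : `|t ^+ 2 / 2 * v| ^+ 2 * expR `|t ^+ 2 / 2 * v|
    <= t ^+ 4 * ((v / 2) ^+ 2 * expR `|v / 2|).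
  rewrite expr_even_normr//.
  have -> : (t ^+ 2 / 2 * v) ^+ 2 = t ^+ 4 * (v / 2) ^+ 2 by field.
  rewrite -[X in X <= _]mulrA.
  rewrite ler_wpM2l ?exprn_even_ge0// ler_wpM2l ?exprn_even_ge0// ler_expR.
  rewrite -mulrA (mulrC _^-1) normrM ler_piMl// [`|t ^+ 2|]ger0_norm ?sqr_ge0//.
  by rewrite exprn_ile1// ltW.
move=> H3; have {}H2 := le_trans H2 H3.
rewrite /C; move: H1 H2.
set E := expR _; set g := \int[P]_w G w; set K := _ * expR _.
rewrite expr0 expr1 fact0 (_ : (1 + 0)`! = 1)%N// !divr1 addr0.
set A := _ - _; set B := _ - _ => H1 H2.
(* [A] and [B] are the two remainders; their common value [E] cancels in [B - A]. *)
have -> : m1 * t + (m2 / 2 - v / 2) * t ^+ 2 + m3 / 6 * t ^+ 3 = B - A.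
  by rewrite /A /B; field.
rewrite (le_trans (ler_normB _ _))//; move: H1 H2; lra.
Qed.

End moments_of_mgf.

(** * Moments of products of Gaussian linear forms *)

Section gaussian_moments.
Context (R : realType) (n : nat) (dT : measure_display) (T : measurableType dT)
  (P : probability T R) (Z : T -> 'rV[R]_n) (m : 'rV[R]_n) (S : 'M[R]_n).
Hypothesis gZ : gaussian_vector P Z m S.
Implicit Types u v : 'rV[R]_n.

Let lin u w := ((Z w - m) *m u^T) 0 0.

Let linD u v w : lin (u + v) w = lin u w + lin v w.
Proof. by rewrite /lin linearD/= mulmxDr mxE. Qed.

Let m_lin u : measurable_fun setT (lin u).
Proof.
have [_ _ mZ _] := gZ.
rewrite /lin; under eq_fun do rewrite mxE; apply: measurable_sum => i.
apply: measurable_funM => //; under eq_fun do rewrite mxE.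
by apply: measurable_funD => //; exact: mZ.
Qed.

Let mgf u t := gaussian_mgf u t gZ.

Let L1lin u k : (k <= 4)%N -> L1 P (fun w => lin u w ^+ k).
Proof. exact: (mgf_L1_expr (m_lin u) (mgf u)). Qed.

Lemma gaussian_moment1 u : \int[P]_w (((Z w - m) *m u^T) 0 0) = 0.
Proof. by have [] := mgf_moments (m_lin u) (mgf u). Qed.

(** Polarization of the square reduces the mixed moment to second moments of single linear forms. *)
Lemma gaussian_moment2 u v :
  \int[P]_w (((Z w - m) *m u^T) 0 0 * ((Z w - m) *m v^T) 0 0)
    = (u *m S *m v^T) 0 0.
Proof.
have e2 x : \int[P]_w (lin x w ^+ 2) = (x *m S *m x^T) 0 0.
  by have [] := mgf_moments (m_lin x) (mgf x).
rewrite -[LHS]/(\int[P]_w (lin u w * lin v w)).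
have -> : \int[P]_w (lin u w * lin v w) = \int[P]_w
    (2^-1 * (lin (u + v) w ^+ 2 - lin u w ^+ 2 - lin v w ^+ 2)).
  by apply: eq_Rintegral => w _; rewrite linD; field.
have L2 x : L1 P (fun w => lin x w ^+ 2) by exact: L1lin.
rewrite RintegralZl//; last by apply: L1B => //; exact: L1B.
rewrite RintegralB//; last exact: L1B.
rewrite RintegralB// !e2.
have [Ssym _ _ _] := gZ.
rewrite linearD/= !(mulmxDl, mulmxDr) !mxE.
(* Symmetry of [S] identifies the two cross terms. *)
have -> : \sum_j (v *m S) 0 j * u^T j 0 = \sum_j (u *m S) 0 j * v^T j 0.
  have <- : (v *m S *m u^T) 0 0 = \sum_j (v *m S) 0 j * u^T j 0 by rewrite mxE.
  have -> : v *m S *m u^T = (u *m S *m v^T)^T.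
    by rewrite !trmx_mul trmxK Ssym mulmxA.
  by rewrite !mxE.
by field.
Qed.

Lemma gaussian_moment3 u1 u2 u3 :
  \int[P]_w (((Z w - m) *m u1^T) 0 0 *
    (((Z w - m) *m u2^T) 0 0 * ((Z w - m) *m u3^T) 0 0)) = 0.
Proof.
have e3 x : \int[P]_w (lin x w ^+ 3) = 0.
  by have [] := mgf_moments (m_lin x) (mgf x).
have L3 x : L1 P (fun w => lin x w ^+ 3) by exact: L1lin.
rewrite -[LHS]/(\int[P]_w (lin u1 w * (lin u2 w * lin u3 w))).
(* polarization of the cube *)
have -> : \int[P]_w (lin u1 w * (lin u2 w * lin u3 w)) = \int[P]_w
   (\sum_(p <- [:: (6^-1, u1 + u2 + u3); (- 6^-1, u1 + u2); (- 6^-1, u2 + u3);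
      (- 6^-1, u1 + u3); (6^-1, u1); (6^-1, u2); (6^-1, u3)])
      p.1 * lin p.2 w ^+ 3).
  apply: eq_Rintegral => w _; rewrite !big_cons big_nil /= !linD.
  by field.
rewrite Rint_sum => [|p]; last exact: L1Z.
by apply: big1 => p _; rewrite RintegralZl// e3 mulr0.
Qed.

Lemma gaussian_L1_moment4 u : L1 P (fun w => ((Z w - m) *m u^T) 0 0 ^+ 4).
Proof. exact: (L1lin u (k := 4)). Qed.

Lemma gaussian_moment4 u (s : R) : 0 < s -> (u *m S *m u^T) 0 0 <= s ->
  \int[P]_w (((Z w - m) *m u^T) 0 0 ^+ 4) <= 48 * expR 1 * s ^+ 2.
Proof. exact: (mgf_moment4 (m_lin u) (mgf u)). Qed.

End gaussian_moments.

Lemma mulmx_basis_vec (R : realType) (n : nat) (z : 'rV[R]_n) (i : 'I_n) :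
  (z *m (basis_vec R i)^T) 0 0 = z 0 i.
Proof.
by rewrite /basis_vec trmx_delta -colE mxE.
Qed.

(** * Measurability of continuous functions of a random vector *)

(** The preimage of []a, +oo[] is a countable union over the rational boxes on which [h] exceeds
    [a], and membership of [Z w] in a box is a finite conjunction of conditions on coordinates. *)
Lemma measurable_continuous_comp (R : realType) (n : nat)
    (dT : measure_display) (T : measurableType dT) (h : 'rV[R]_n -> R)
    (Z : T -> 'rV[R]_n) :
  continuous h -> (forall i, measurable_fun setT (fun w => Z w 0 i)) ->
  measurable_fun setT (fun w => h (Z w)).
Proof.
move=> ch mZ; apply: (measurability _ (RGenOInfty.measurableE R)) => //.
move=> /= _ [_ [a ->] <-]; rewrite setTI.
pose near_ (p : 'rV[rat]_n * nat) (y : 'rV[R]_n) :=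
  forall i, `|y 0 i - ratr (p.1 0 i)| < p.2.+1%:R^-1.
pose F p := if `[< forall y, near_ p y -> a < h y >]
  then [set w | near_ p (Z w)] else set0.
have -> : (fun w => h (Z w)) @^-1` `]a, +oo[ = \bigcup_p F p.
  apply/seteqP; split=> [w|w [p _]]; last first.
    rewrite /F; case: asboolP => // H /H /= ah.
    by rewrite in_itv /= andbT.
  rewrite /= in_itv /= andbT => ahZ.
  have := ch (Z w); move=> /(_ _ (open_nbhs_nbhs (conj (@open_gt _ a) ahZ))).
  move=> /nbhs_ballP[e /= e0 He].
  (* With half-side below [e / 2], a box that contains [Z w] lies in the ball of radius [e] around
     it. *)
  have [N _ /(_ N (leqnn N)) /= Ne] :=
    near_infty_natSinv_lt (PosNum (divr_gt0 e0 (ltr0n _ 2))).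
  have : exists c : 'rV[rat]_n, near_ (c, N) (Z w).
    have q i : exists q : rat, `|Z w 0 i - ratr q| < N.+1%:R^-1.
      have : Z w 0 i - N.+1%:R^-1 < Z w 0 i + N.+1%:R^-1.
        by rewrite ltrD2l gt0_cp// invr_gt0.
      move=> /rat_in_itvoo[q]; rewrite in_itv /= => /andP[q1 q2].
      by exists q; rewrite distrC ltr_distl q1 q2.
    exists (\row_i sval (cid (q i))) => i /=.
    by rewrite mxE; case: cid.
  move=> [c cZ]; exists (c, N) => //; rewrite /F; case: asboolP => // -[].
  move=> y cy; apply: He; split => // i j; rewrite ord1.
  rewrite /ball /= /ball_; have := cy j; have := cZ j => /= h1 h2.
  rewrite -[Z w 0 j](subrK (ratr (c 0 j))) -addrA (le_lt_trans (ler_normD _ _))//.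
  rewrite [e]splitr ltrD// ?(lt_trans h1)// distrC (lt_trans h2)//.
apply: countable_bigcupT_measurable => // p.
rewrite /F; case: asboolP => // _.
have -> : [set w | near_ p (Z w)] = \bigcap_(i in [set: 'I_n])
    ((fun w => `|Z w 0 i - ratr (p.1 0 i)|) @^-1` `]-oo, p.2.+1%:R^-1[).
  apply/seteqP; split=> w /= H i; have := H i; rewrite /= in_itv //=.
  exact.
apply: fin_bigcap_measurable => // i _.
rewrite -[X in measurable X]setTI.
suff: measurable_fun setT (fun w => `|Z w 0 i - ratr (p.1 0 i)|) by exact.
apply: measurableT_comp; first exact: normr_measurable.
exact: measurable_funB.
Qed.

(** * Bounds on partial derivatives and on monomials *)

Section partials.
Context (R : realType) (n : nat).
Implicit Types (z : 'rV[R]_n).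

(** Differentiability is asked from order 0 on, bounds only from order 1 on: neither the seminorm
    nor the assumption on [f] controls the function itself. *)
Definition bounded_partials (k : nat) (M : R) (g : 'rV[R]_n -> R) :=
  (forall J y, (size J < k)%N -> differentiable (partial g J) y) /\
  (forall J y, (0 < size J <= k)%N -> `|partial g J y| <= M).

Lemma bounded_partials_taylor g k j (M : R) x z :
  bounded_partials k M g -> (0 < j <= k)%N ->
  `|g (x + z) - \sum_(i < j) (i`!%:R)^-1 * nderive g (nseq i z) x|
    <= M * l1norm z ^+ j.
Proof.
move=> [dg Mg] /andP[j0 jk]; apply: taylor_rV => J y Jj.
  by apply: dg; exact: leq_trans jk.
by apply: Mg; rewrite Jj j0.
Qed.

Lemma bounded_partials_nderive g k i (M : R) x z :
  bounded_partials k M g -> (i <= k)%N ->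
  nderive g (nseq i z) x = \sum_(J <- words n i) monom z J * partial g J x.
Proof.
move=> [dg _] ik; apply: nderive_words => J y Ji.
by apply: dg; exact: leq_trans ik.
Qed.

Lemma enorm_basis_vec (i : 'I_n) : enorm (basis_vec R i) <= 1.
Proof.
rewrite /enorm (bigD1 i)//= big1 => [|j ji].
  by rewrite /basis_vec mxE !eqxx expr1n addr0 sqrtr1.
by rewrite /basis_vec mxE eqxx /= (negbTE ji) expr0n.
Qed.

Lemma nderive_le_sup_deriv_norm (W : normedModType R) (N : W -> R)
    (f : 'rV[R]_n -> W) (vs : seq 'rV[R]_n) (x : 'rV[R]_n) :
  (forall v, v \in vs -> enorm v <= 1) ->
  ((N (nderive f vs x))%:E <= sup_deriv_norm N (size vs) f)%E.
Proof.
move=> vs1; pose A (v : (size vs).-tuple 'rV[R]_n) := nderive f v x.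
apply: (@le_trans _ _ (opnorm N A)); last first.
  by apply: ereal_sup_ubound; exists x.
apply: ereal_sup_ubound; exists (in_tuple vs) => //= i.
exact/vs1/(mem_tnth i (in_tuple vs)).
Qed.

(** Evaluation of a coordinate is continuous, so it commutes with the limit of the vector-valued
    difference quotients, which exists by differentiability. *)
Lemma nderive_coord (d : nat) (f : 'rV[R]_n -> 'rV[R]_d) (a : 'I_d) (k : nat)
    (vs : seq 'rV[R]_n) :
  times_differentiable k f -> (size vs <= k)%N ->
  nderive (fun x => f x 0 a) vs = fun x => nderive f vs x 0 a.
Proof.
move=> df; elim: vs => [|v vs IH] //= vsk.
rewrite IH ?(ltnW vsk)//; apply/funext => x.
have dG := nderive_differentiable df vsk x.
apply: cvg_lim => //.
have -> : (fun h : R => h^-1 *: (((fun y => nderive f vs y 0 a) \o shift x) (h *: v)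
    - nderive f vs x 0 a)) =
  (fun M : 'rV[R]_d => M 0 a) \o
    (fun h : R => h^-1 *: ((nderive f vs \o shift x) (h *: v) - nderive f vs x)).
  by apply/funext => h /=; rewrite !mxE.
apply: cvg_comp; last exact: coord_continuous.
exact: diff_derivable.
Qed.

Lemma coord_le_enorm (d : nat) (v : 'rV[R]_d) (a : 'I_d) : `|v 0 a| <= enorm v.
Proof.
rewrite -sqrtr_sqr ler_wsqrtr// (bigD1 a)//= lerDl sumr_ge0// => i _.
exact: sqr_ge0.
Qed.

Lemma bounded_partials_coord (d : nat) (f : 'rV[R]_n -> 'rV[R]_d) (k : nat) :
  times_differentiable k f ->
  (forall j : nat, (1 <= j <= k)%N ->
     (sup_deriv_norm (@enorm R d) j f < +oo)%E) ->
  exists2 M : R, 0 < M &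
    forall a, bounded_partials k M (fun x => f x 0 a).
Proof.
move=> df bf.
pose B j := fine (sup_deriv_norm (@enorm R d) j f).
(* One constant serves all orders. The summand 1 makes it positive; the term of order 0, possibly
   infinite before [fine], only enlarges the bound. *)
exists (1 + \sum_(j < k.+1) `|B j|) => [|a].
  by rewrite ltr_pwDl// sumr_ge0.
split=> J y Jk.
  rewrite /partial (nderive_coord _ df) ?size_map ?(ltnW Jk)//.
  have dG := nderive_differentiable df (vs := [seq basis_vec R i | i <- J]).
  rewrite size_map in dG.
  exact: (differentiable_comp (dG Jk y) (differentiable_coord _ _ _)).
have /andP[J0 Jk'] := Jk.
rewrite /partial (nderive_coord _ df) ?size_map//.
rewrite (le_trans (coord_le_enorm _ _))//.
apply: (@le_trans _ _ (B (size J))).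
  have le_sup := nderive_le_sup_deriv_norm (@enorm R d) f y
    (vs := [seq basis_vec R i | i <- J]).
  rewrite size_map in le_sup.
  have {}le_sup : ((enorm (nderive f [seq basis_vec R i | i <- J] y))%:E <=
      sup_deriv_norm (@enorm R d) (size J) f)%E.
    by apply: le_sup => v /mapP[i _ ->]; exact: enorm_basis_vec.
  rewrite -lee_fin /B fineK// fin_numElt bf// andbT.
  by apply: lt_le_trans le_sup; rewrite ltNyr.
apply: (le_trans (ler_norm _)).
rewrite (bigD1 (Ordinal (Jk' : (size J < k.+1)%N)))//= addrCA lerDl.
by rewrite addr_ge0// sumr_ge0.
Qed.

Lemma bounded_partials_sobolev4 (h : 'rV[R]_n -> R) :
  times_differentiable 4 h -> (sobolev4 h <= 1)%E -> bounded_partials 4 1 h.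
Proof.
move=> dh h1; split=> J y J4.
  by apply: (nderive_differentiable dh); rewrite size_map.
rewrite -lee_fin; apply: le_trans h1.
apply: (@le_trans _ _ (sup_deriv_norm (fun r : R => `|r|%R) (size J) h)).
  rewrite -(size_map (@basis_vec R n) J).
  apply: (nderive_le_sup_deriv_norm (fun r : R => `|r|%R)) => v /mapP[i _ ->].
  exact: enorm_basis_vec.
rewrite /sobolev4 (bigD1_seq (size J)) ?iota_uniq ?mem_index_iota//=.
by rewrite le_max lexx.
Qed.

Lemma norm_monom_le z J : `|monom z J| <= l1norm z ^+ size J.
Proof.
elim: J => [|i J IH]; first by rewrite /monom big_nil normr1 expr0.
rewrite /monom big_cons normrM exprS ler_pM// /l1norm (bigD1 i)//= lerDl.
exact: sumr_ge0.
Qed.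

Lemma l1norm_ge0 z : 0 <= l1norm z.
Proof. exact: sumr_ge0. Qed.

(** Cauchy-Schwarz against the constant vector, from [c i * c j <= (c i ^+ 2 + c j ^+ 2) / 2]. *)
Lemma sqr_sum_le (c : 'I_n -> R) :
  (\sum_i c i) ^+ 2 <= n%:R * \sum_i c i ^+ 2.
Proof.
rewrite expr2 big_distrl /=.
apply: (@le_trans _ _ (\sum_i \sum_j (c i ^+ 2 / 2 + c j ^+ 2 / 2))).
  apply: ler_sum => i _; rewrite big_distrr /=; apply: ler_sum => j _.
  have := sqr_ge0 (c i - c j); rewrite sqrrB; lra.
set A := \sum_i c i ^+ 2.
have -> : \sum_i \sum_j (c i ^+ 2 / 2 + c j ^+ 2 / 2) =
    \sum_i (n%:R * (c i ^+ 2 / 2) + A / 2).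
  apply: eq_bigr => i _.
  by rewrite big_split/= sumr_const card_ord mulr_natl -mulr_suml.
rewrite big_split /= -mulr_sumr sumr_const card_ord -mulr_suml.
by rewrite -/A -[(A / 2) *+ n]mulr_natl -mulrDr -splitr.
Qed.

Lemma l1norm_sqr_le z : l1norm z ^+ 2 <= n%:R * \sum_i z 0 i ^+ 2.
Proof.
rewrite (le_trans (sqr_sum_le _))//.
by under eq_bigr do rewrite expr_even_normr//.
Qed.

Lemma l1norm_expr4_le z : l1norm z ^+ 4 <= n%:R ^+ 3 * \sum_i z 0 i ^+ 4.
Proof.
rewrite (exprM _ 2 2).
apply: (@le_trans _ _ ((n%:R * \sum_i z 0 i ^+ 2) ^+ 2)).
  rewrite ler_sqr ?nnegrE ?l1norm_sqr_le ?exprn_ge0 ?l1norm_ge0//.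
  by rewrite (le_trans _ (l1norm_sqr_le _))// exprn_ge0// l1norm_ge0.
rewrite exprMn [n%:R ^+ 3]exprSr -[leRHS]mulrA ler_wpM2l ?exprn_ge0//.
rewrite (le_trans (sqr_sum_le _))//.
by under eq_bigr do rewrite -exprM.
Qed.

End partials.

(** * Taylor expansion of expectations and the upper bound on [d4] *)

(** The centre [m] is the future expansion point. By domination these conditions yield every mixed
    moment of order at most 4. *)
Definition finite_moment4 (R : realType) (n : nat) (dT : measure_display)
    (T : measurableType dT) (P : probability T R) (U : T -> 'rV[R]_n)
    (m : 'rV[R]_n) :=
  (forall i, measurable_fun setT (fun w => U w 0 i)) /\
  (forall i, L1 P (fun w => (U w - m) 0 i ^+ 4)).

Section expansion.
Context (R : realType) (n : nat) (dT : measure_display) (T : measurableType dT)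
  (P : probability T R) (U : T -> 'rV[R]_n) (m : 'rV[R]_n).
Hypothesis U4 : finite_moment4 P U m.

Let mU i : measurable_fun setT (fun w => (U w - m) 0 i).
Proof.
under eq_fun do rewrite !mxE.
by apply: measurable_funB => //; exact: U4.1.
Qed.

Lemma measurable_l1norm : measurable_fun setT (fun w => l1norm (U w - m)).
Proof.
by apply: measurable_sum => i; apply: measurableT_comp.
Qed.

Lemma L1_l1norm k : (k <= 4)%N -> L1 P (fun w => l1norm (U w - m) ^+ k).
Proof.
move=> k4; apply: (@L1_le _ _ _ _ _
    (fun w => 1 + n%:R ^+ 3 * \sum_i (U w - m) 0 i ^+ 4)).
- by apply: measurable_funX; exact: measurable_l1norm.
- apply: L1D; first exact: L1_cst.
  by apply: L1Z; apply: L1_sum => i; exact: U4.2.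
move=> w; rewrite ger0_norm ?exprn_ge0 ?l1norm_ge0//.
rewrite (le_trans (exprn_le_1Dexpr4 (l1norm_ge0 _) k4))// lerD2l.
exact: l1norm_expr4_le.
Qed.

Lemma L1_monom J : (size J <= 4)%N -> L1 P (fun w => monom (U w - m) J).
Proof.
move=> J4; apply: (@L1_le _ _ _ _ _ (fun w => l1norm (U w - m) ^+ size J)).
- by apply: measurable_prod => i _; exact: mU.
- exact: L1_l1norm.
- by move=> w; exact: norm_monom_le.
Qed.

Lemma L1_coord i : L1 P (fun w => U w 0 i).
Proof.
have -> : (fun w => U w 0 i) = fun w => monom (U w - m) [:: i] + m 0 i.
  by apply/funext => w; rewrite /monom big_seq1 !mxE subrK.
by apply: L1D; [exact: L1_monom|exact: L1_cst].
Qed.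

Lemma integral_monom1 i :
  \int[P]_w monom (U w - m) [:: i] = \int[P]_w U w 0 i - m 0 i.
Proof.
rewrite -[X in _ - X](Rint_cst P) -RintegralB//; last first.
- exact: L1_cst.
- exact: L1_coord.
by apply: eq_Rintegral => w _; rewrite /monom big_seq1 mxE [X in _ + X]mxE.
Qed.

(** A bounded first derivative gives [g] at most linear growth away from [m], so first moments
    suffice. *)
Lemma L1_bounded_partials g M : bounded_partials 4 M g ->
  L1 P (fun w => g (U w)).
Proof.
move=> gM.
apply: (@L1_le _ _ _ _ _ (fun w => `|g m| + M * l1norm (U w - m) ^+ 1)).
- apply: measurable_continuous_comp; last exact: U4.1.
  move=> x; apply: differentiable_continuous.
  exact: (gM.1 [::] x isT).
- by apply: L1D; [exact: L1_cst|apply: L1Z; exact: L1_l1norm].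
move=> w; have := bounded_partials_taylor m (U w - m) gM (j := 1) isT.
rewrite big_ord_recl big_ord0 /= fact0 invr1 mul1r addr0 (addrC m) subrK => H.
by rewrite -[g (U w)](subrK (g m)) addrC (le_trans (ler_normD _ _))// lerD2l.
Qed.

(** Integrating the pointwise expansion separates the two ingredients: apart from the remainder, [U]
    enters through its moments about [m] and [g] through its derivatives at [m]. *)
Lemma expectation_taylor g k : bounded_partials 4 1 g -> (0 < k <= 4)%N ->
  `|\int[P]_w g (U w) - \sum_(i < k) (i`!%:R)^-1 * \sum_(J <- words n i)
      (\int[P]_w monom (U w - m) J) * partial g J m|
    <= \int[P]_w (l1norm (U w - m) ^+ k).
Proof.
move=> g1 k4; have [k0 k4'] := andP k4.
pose p w := \sum_(i < k) (i`!%:R)^-1 * nderive g (nseq i (U w - m)) m.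
have i4 (i : 'I_k) : (i <= 4)%N by rewrite (leq_trans _ k4')// ltnW.
have LJ i J : (J \in words n i) -> (i <= 4)%N ->
    L1 P (fun w => partial g J m * monom (U w - m) J).
  by move=> /size_words Ji i4'; apply: L1Z; apply: L1_monom; rewrite Ji.
have nE (i : 'I_k) : (fun w => nderive g (nseq i (U w - m)) m) =
   fun w => \sum_(j < size (words n i)) partial g (nth [::] (words n i) j) m *
     monom (U w - m) (nth [::] (words n i) j).
  apply/funext => w; rewrite (bounded_partials_nderive _ _ g1 (i4 i)).
  by rewrite (big_nth [::]) big_mkord; apply: eq_bigr => j _; rewrite mulrC.
have Ln (i : 'I_k) : L1 P (fun w => nderive g (nseq i (U w - m)) m).
  rewrite nE; apply: L1_sum => j.
  exact: (LJ i _ (mem_nth _ (ltn_ord j)) (i4 i)).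
have Lp : L1 P p by apply: L1_sum => i; exact: L1Z.
have -> : \sum_(i < k) (i`!%:R)^-1 * \sum_(J <- words n i)
    (\int[P]_w monom (U w - m) J) * partial g J m = \int[P]_w p w.
  rewrite Rint_sum => [|i]; last exact: L1Z.
  apply: eq_bigr => i _; rewrite RintegralZl//; congr (_ * _).
  have /= -> := congr1 (fun F => \int[P]_w F w) (nE i).
  rewrite Rint_sum => [|j]; last first.
    exact: (LJ i _ (mem_nth _ (ltn_ord j)) (i4 i)).
  rewrite (big_nth [::]) big_mkord; apply: eq_bigr => j _.
  rewrite RintegralZl// 1?mulrC//; apply: L1_monom.
  by rewrite (size_words (mem_nth [::] (ltn_ord j))).
have Lg := L1_bounded_partials g1.
rewrite -RintegralB//; apply: norm_Rint_le.
- exact: L1B.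
- exact: L1_l1norm.
move=> w; have := bounded_partials_taylor m (U w - m) g1 k4.
by rewrite mul1r (addrC m) subrK.
Qed.

End expansion.

Lemma gaussian_finite_moment4 (R : realType) (n : nat) (dT : measure_display)
    (T : measurableType dT) (P : probability T R) (Z : T -> 'rV[R]_n)
    (m : 'rV[R]_n) (S : 'M[R]_n) :
  gaussian_vector P Z m S -> finite_moment4 P Z m.
Proof.
move=> gZ; split=> i; first by have [_ _ +] := gZ.
have := gaussian_L1_moment4 gZ (basis_vec R i).
by under eq_fun do rewrite mulmx_basis_vec.
Qed.

Section comparison.
Context (R : realType) (n : nat).
Context (dT : measure_display) (T : measurableType dT) (P : probability T R)
  (U : T -> 'rV[R]_n).
Context (dT' : measure_display) (T' : measurableType dT') (Q : probability T' R)
  (V : T' -> 'rV[R]_n).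
Context (m : 'rV[R]_n).
Hypotheses (U4 : finite_moment4 P U m) (V4 : finite_moment4 Q V m).

(** Both expectations are expanded at the same point [m]. The two remainders give the first two
    terms; in the sum, the inverse factorials and the partial derivatives of the test function are
    bounded by 1. *)
Lemma d4_le_moments k : (0 < k <= 4)%N ->
  (d4 P U Q V <= (\int[P]_w (l1norm (U w - m) ^+ k) +
    \int[Q]_w (l1norm (V w - m) ^+ k) +
    \sum_(1 <= i < k) \sum_(J <- words n i)
      `|\int[P]_w monom (U w - m) J - \int[Q]_w monom (V w - m) J|)%:E)%E.
Proof.
move=> k4; apply: ge_ereal_sup => _ [h [dh h1] <-].
have hp := bounded_partials_sobolev4 dh h1.
have LP := L1_bounded_partials U4 hp.
have LQ := L1_bounded_partials V4 hp.
rewrite unlock -(fineK (integrable_fin_num _ LP))// -(fineK (integrable_fin_num _ LQ))//.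
rewrite -EFinB lee_fin.
rewrite -[fine _]/(\int[P]_w h (U w)) -[X in _ - X]/(\int[Q]_w h (V w)).
have eU := expectation_taylor U4 hp k4.
have eV := expectation_taylor V4 hp k4.
move: eU eV; set a := \int[P]_w h _; set b := \int[Q]_w h _.
set NU := \int[P]_w _; set NV := \int[Q]_w _; set sU := \sum_(_ < _) _.
set sV := \sum_(_ < _) _ => eU eV.
have -> : a - b = (a - sU) - (b - sV) + (sU - sV) by ring.
rewrite (le_trans (ler_normD _ _))// lerD//.
  by rewrite (le_trans (ler_normB _ _))// lerD.
rewrite /sU /sV; case/andP: k4 => k0 k4; move: k0 k4 => {a b NU NV sU sV eU eV}.
case: k => // k _ k4.
(* The term of order 0 is [h m] on both sides, as [P] and [Q] have mass 1, and cancels. *)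
rewrite !big_ord_recl /= !big_seq1 /monom.
under [X in `|_ * (X * _) + _ - _|]eq_Rintegral do rewrite big_nil.
under [X in `|_ - (_ * (X * _) + _)|]eq_Rintegral do rewrite big_nil.
rewrite !Rint_cst opprD addrACA subrr add0r -sumrB.
rewrite (le_trans (ler_norm_sum _ _ _))// big_add1 big_mkord /=.
apply: ler_sum => i _.
rewrite -mulrBr -sumrB normrM.
have i1 : `|((bump 0 i)`!%:R : R)^-1| <= 1.
  by rewrite normfV normr_nat invf_le1 ?ltr0n ?fact_gt0// ler1n fact_gt0.
apply: (le_trans (ler_wpM2r (normr_ge0 _) i1)); rewrite mul1r.
rewrite (le_trans (ler_norm_sum _ _ _))// big_seq [leRHS]big_seq.
apply: ler_sum => J Jw; have Ji := @size_words n i.+1 J Jw.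
rewrite -mulrBl normrM ler_piMr//; apply: hp.2.
by rewrite Ji (leq_trans (ltn_ord i) (ltnW k4)).
Qed.

End comparison.

Lemma ler_sum_words (R : realType) (n k : nat) (F : seq 'I_n -> R) (c : R) :
  (forall J, size J = k -> F J <= c) ->
  \sum_(J <- words n k) F J <= (size (words n k))%:R * c.
Proof.
move=> Fc; apply: (@le_trans _ _ (\sum_(J <- words n k) c)).
  by rewrite big_seq [leRHS]big_seq; apply: ler_sum => J /size_words /Fc.
by rewrite big_const_seq count_predT iter_addr_0 mulr_natl.
Qed.

(** * Gaussian moments in coordinates *)

Section gaussian_monom.
Context (R : realType) (n : nat) (dT : measure_display) (T : measurableType dT)
  (P : probability T R) (Z : T -> 'rV[R]_n) (m : 'rV[R]_n) (S : 'M[R]_n).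
Hypothesis gZ : gaussian_vector P Z m S.

Lemma basis_vec_form (i j : 'I_n) :
  (basis_vec R i *m S *m (basis_vec R j)^T) 0 0 = S i j.
Proof. by rewrite mulmx_basis_vec /basis_vec -rowE mxE. Qed.

Lemma gaussian_monom1 i : \int[P]_w monom (Z w - m) [:: i] = 0.
Proof.
rewrite -[RHS](gaussian_moment1 gZ (basis_vec R i)).
apply: eq_Rintegral => w _.
by rewrite /monom big_seq1 mulmx_basis_vec.
Qed.

Lemma gaussian_monom2 i j : \int[P]_w monom (Z w - m) [:: i; j] = S i j.
Proof.
rewrite -basis_vec_form -(gaussian_moment2 gZ).
apply: eq_Rintegral => w _.
by rewrite /monom big_cons big_seq1 !mulmx_basis_vec.
Qed.

Lemma gaussian_monom3 i j k : \int[P]_w monom (Z w - m) [:: i; j; k] = 0.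
Proof.
rewrite -[RHS](gaussian_moment3 gZ (basis_vec R i) (basis_vec R j) (basis_vec R k)).
apply: eq_Rintegral => w _.
by rewrite /monom !big_cons big_nil mulr1 !mulmx_basis_vec.
Qed.

Lemma gaussian_l1norm_sqr :
  \int[P]_w (l1norm (Z w - m) ^+ 2) <= n%:R * \sum_i S i i.
Proof.
have Z4 := gaussian_finite_moment4 gZ.
have L2 i : L1 P (fun w => (Z w - m) 0 i ^+ 2).
  have := @L1_monom _ _ _ _ _ _ _ Z4 [:: i; i] isT.
  by under eq_fun do rewrite /monom big_cons big_seq1 -expr2.
have -> : n%:R * \sum_i S i i =
    \int[P]_w (n%:R * \sum_i (Z w - m) 0 i ^+ 2).
  rewrite RintegralZl//; last exact: L1_sum.
  rewrite Rint_sum//; congr (_ * _); apply: eq_bigr => i _.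
  rewrite -gaussian_monom2; apply: eq_Rintegral => w _.
  by rewrite /monom big_cons big_seq1 expr2.
apply: le_Rint; first exact: (L1_l1norm Z4).
  by apply: L1Z; exact: L1_sum.
by move=> w; exact: l1norm_sqr_le.
Qed.

(** Three factors [n] come from comparing the l1 norm with fourth powers of coordinates, the last
    one from summing over the coordinates. *)
Lemma gaussian_l1norm_expr4 (s : R) : 0 < s -> (forall i, S i i <= s) ->
  \int[P]_w (l1norm (Z w - m) ^+ 4) <= n%:R ^+ 4 * (48 * expR 1 * s ^+ 2).
Proof.
move=> s0 Ss; have Z4 := gaussian_finite_moment4 gZ.
have L4 := Z4.2.
apply: (@le_trans _ _ (\int[P]_w (n%:R ^+ 3 * \sum_i (Z w - m) 0 i ^+ 4))).
  apply: le_Rint; first exact: (L1_l1norm Z4).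
    by apply: L1Z; exact: L1_sum.
  by move=> w; exact: l1norm_expr4_le.
rewrite RintegralZl//; last exact: L1_sum.
rewrite Rint_sum// [n%:R ^+ 4]exprSr -mulrA ler_wpM2l ?exprn_ge0//.
apply: (@le_trans _ _ (\sum_(i < n) (48 * expR 1 * s ^+ 2))); last first.
  by rewrite sumr_const card_ord -[X in X <= _]mulr_natl.
apply: ler_sum => i _.
have := gaussian_moment4 gZ (u := basis_vec R i) s0.
rewrite basis_vec_form => /(_ (Ss i)); apply: le_trans.
rewrite le_eqVlt; apply/orP; left; apply/eqP.
by apply: eq_Rintegral => w _; rewrite mulmx_basis_vec.
Qed.

End gaussian_monom.

Lemma mean_vecE (R : realType) (d : nat) (dT : measure_display)
    (T : measurableType dT) (P : probability T R) (Z : T -> 'rV[R]_d) i :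
  mean_vec P Z 0 i = \int[P]_w Z w 0 i.
Proof. by rewrite mxE unlock. Qed.

(** * Moments of [f (mu + e *: xi)] in powers of [e] *)

(** The base is at least 1, so this single number dominates the moments of [l1norm (xi w)] of every
    order up to 4. *)
Definition growth4 (R : realType) (n : nat) (dT : measure_display)
    (T : measurableType dT) (P : probability T R) (xi : T -> 'rV[R]_n) :=
  \int[P]_w ((1 + l1norm (xi w)) ^+ 4).

Section delta_method.
Context (R : realType) (n d : nat) (mu : 'rV[R]_n) (Sigma : 'M[R]_n)
  (f : 'rV[R]_n -> 'rV[R]_d) (dT : measure_display) (T : measurableType dT)
  (P : probability T R) (xi : T -> 'rV[R]_n) (M : R).
Hypothesis xi_gauss : gaussian_vector P xi 0 Sigma.
Hypothesis M0 : 0 < M.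
Hypothesis fM : forall a, bounded_partials 4 M (fun x => f x 0 a).

Let N w := l1norm (xi w).
Let W w := 1 + N w.
Let K := growth4 P xi.
Let fa a := fun x => f x 0 a.
Let L a w := nderive (fa a) [:: xi w] mu.
Let Q a w := nderive (fa a) [:: xi w; xi w] mu.

Let N0 w : 0 <= N w. Proof. exact: l1norm_ge0. Qed.
Let W1 w : 1 <= W w. Proof. by rewrite lerDl. Qed.
Let W0 w : 0 <= W w. Proof. exact: le_trans (W1 w). Qed.
Let NW w : N w <= W w. Proof. by rewrite lerDr. Qed.

Let mN : measurable_fun setT N.
Proof.
have := measurable_l1norm (gaussian_finite_moment4 xi_gauss).
by under eq_fun do rewrite subr0.
Qed.

Let LN k : (k <= 4)%N -> L1 P (fun w => N w ^+ k).
Proof.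
move=> k4; have := L1_l1norm (gaussian_finite_moment4 xi_gauss) k4.
by under eq_fun do rewrite subr0.
Qed.

Let LW4 : L1 P (fun w => W w ^+ 4).
Proof.
have -> : (fun w => W w ^+ 4) = fun w => (1 + 4 * N w ^+ 1) +
    (6 * N w ^+ 2 + (4 * N w ^+ 3 + N w ^+ 4)).
  by apply/funext => w; rewrite /W; ring.
by apply: L1D; [apply: L1D; [exact: L1_cst|]|apply: L1D; [|apply: L1D]];
  do ?apply: L1Z; exact: LN.
Qed.

Let K0 : 0 <= K.
Proof. by apply: Rintegral_ge0 => w _; rewrite exprn_ge0 ?W0. Qed.

(* Every error term below is pointwise at most a constant times [W ^+ k] with
   [k <= 4]. *)
Let integral_le_W (g : T -> R) (k : nat) (c : R) : measurable_fun setT g ->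
  (k <= 4)%N -> 0 <= c -> (forall w, `|g w| <= c * W w ^+ k) ->
  L1 P g /\ `|\int[P]_w g w| <= c * K.
Proof.
move=> mg k4 c0 gc.
have gW w : `|g w| <= c * W w ^+ 4.
  by rewrite (le_trans (gc w))// ler_wpM2l// ler_weXn2l.
have LcW : L1 P (fun w => c * W w ^+ 4) by exact: L1Z.
have Lg : L1 P g by exact: L1_le LcW gW.
by split=> //; rewrite -RintegralZl//; exact: norm_Rint_le.
Qed.

(** The gradient of [fa a] at [mu]: it presents [L a] as one of the linear forms of the Gaussian
    moment lemmas. *)
Let u a : 'rV[R]_n := \row_j partial (fa a) [:: j] mu.

Let LE a w : L a w = ((xi w - 0) *m (u a)^T) 0 0.
Proof.
rewrite subr0 mxE /L /= (derive_basis _ ((fM a).1 [::] mu isT)).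
by apply: eq_bigr => i _; rewrite !mxE.
Qed.

Let mxi i : measurable_fun setT (fun w => xi w 0 i).
Proof. by have [_ _ +] := xi_gauss. Qed.

Let mL a : measurable_fun setT (L a).
Proof.
rewrite (_ : L a = fun w => \sum_i xi w 0 i * u a 0 i).
  by apply: measurable_sum => i; exact: measurable_funM.
apply/funext => w; rewrite LE subr0 mxE; apply: eq_bigr => i _.
by rewrite !mxE.
Qed.

Let L_le a w : `|L a w| <= M * N w.
Proof.
rewrite LE subr0 mxE (le_trans (ler_norm_sum _ _ _))// /N /l1norm mulr_sumr.
apply: ler_sum => i _; rewrite normrM mulrC ler_wpM2r// !mxE.
exact: (fM a).2.
Qed.

Let QE a w : Q a w = \sum_(J <- words n 2) monom (xi w) J * partial (fa a) J mu.
Proof. exact: (bounded_partials_nderive mu (xi w) (fM a) (i := 2) isT). Qed.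

Let mQ a : measurable_fun setT (Q a).
Proof.
rewrite (_ : Q a = fun w => \sum_(J <- words n 2) monom (xi w) J * partial (fa a) J mu).
  apply: measurable_sum => J; apply: measurable_funM => //.
  by apply: measurable_prod => i _.
by apply/funext => w; exact: QE.
Qed.

Let Q_le a w : `|Q a w| <= M * N w ^+ 2.
Proof.
rewrite QE (le_trans (ler_norm_sum _ _ _))// -norm_monom_words mulr_sumr.
rewrite big_seq [leRHS]big_seq; apply: ler_sum => J /size_words J2.
rewrite normrM mulrC ler_wpM2r//; apply: (fM a).2.
by rewrite J2.
Qed.

Let integral_L a : \int[P]_w L a w = 0.
Proof.
rewrite -(gaussian_moment1 xi_gauss (u a)).
by apply: eq_Rintegral => w _; rewrite LE.
Qed.

Let integral_LLL a b c : \int[P]_w (L a w * (L b w * L c w)) = 0.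
Proof.
rewrite -(gaussian_moment3 xi_gauss (u a) (u b) (u c)).
by apply: eq_Rintegral => w _; rewrite !LE.
Qed.

(** [e] stands for [l^-1]; the bound [e <= 1] lets higher powers of [e] be absorbed by lower
    ones. *)
Variable e : R.
Hypothesis e01 : 0 < e <= 1.
Let e0 : 0 < e. Proof. by case/andP: e01. Qed.
Let e1 : e <= 1. Proof. by case/andP: e01. Qed.

Let Y w := f (mu + e *: xi w).

Let mY a : measurable_fun setT (fun w => Y w 0 a).
Proof.
apply: (measurable_continuous_comp (h := fa a)
  (Z := fun w => mu + e *: xi w)) => [x|i].
  apply: differentiable_continuous.
  exact: ((fM a).1 [::] x isT).
under eq_fun do rewrite !mxE; apply: measurable_funD => //.
exact: measurable_funM.
Qed.

Let nderive_scale a k w : (k <= 4)%N ->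
  nderive (fa a) (nseq k (e *: xi w)) mu = e ^+ k * nderive (fa a) (nseq k (xi w)) mu.
Proof.
move=> k4; rewrite !(bounded_partials_nderive _ _ (fM a) k4) mulr_sumr.
apply: eq_big_seq => J /size_words <-.
rewrite mulrA; congr (_ * _).
rewrite /monom; elim: J => [|i J IH]; first by rewrite !big_nil mulr1.
by rewrite !big_cons IH mxE exprS; ring.
Qed.

Let taylor_Y a k w : (0 < k <= 4)%N ->
  `|Y w 0 a - \sum_(i < k) (i`!%:R)^-1 * (e ^+ i * nderive (fa a) (nseq i (xi w)) mu)|
    <= M * e ^+ k * N w ^+ k.
Proof.
move=> k4; have := bounded_partials_taylor mu (e *: xi w) (fM a) k4.
have -> : l1norm (e *: xi w) = e * N w.
  rewrite /N /l1norm mulr_sumr; apply: eq_bigr => i _.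
  by rewrite mxE normrM gtr0_norm.
rewrite exprMn mulrA; apply: le_trans.
rewrite le_eqVlt; apply/orP; left; apply/eqP; congr (`|_ - _|).
apply: eq_bigr => i _; rewrite nderive_scale//.
by rewrite (leq_trans (ltnW (ltn_ord i)))//; case/andP: k4.
Qed.

Let taylor1 a w : `|Y w 0 a - f mu 0 a| <= M * e * N w.
Proof.
have := taylor_Y a w (k := 1) isT.
by rewrite big_ord_recl big_ord0 /= fact0 invr1 expr0 !mul1r addr0 !expr1.
Qed.

Let taylor2 a w : `|Y w 0 a - f mu 0 a - e * L a w| <= M * e ^+ 2 * N w ^+ 2.
Proof.
have := taylor_Y a w (k := 2) isT.
rewrite !big_ord_recl big_ord0 /= fact0 invr1 expr0 !mul1r addr0.
by rewrite /bump addn0 expr1 opprD addrA.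
Qed.

Let taylor3 a w : `|Y w 0 a - f mu 0 a - e * L a w - e ^+ 2 * (2^-1 * Q a w)|
  <= M * e ^+ 3 * N w ^+ 3.
Proof.
have := taylor_Y a w (k := 3) isT.
rewrite !big_ord_recl big_ord0 /= fact0 invr1 expr0 !mul1r addr0.
rewrite /bump !addn0 expr1 !opprD !addrA.
by rewrite (_ : (1 + 1)`! = 2)%N// -/(L a w) mulrCA.
Qed.

Lemma delta_finite_moment4 (m : 'rV[R]_d) : finite_moment4 P Y m.
Proof.
split=> // a.
have mz : measurable_fun setT (fun w => (Y w - m) 0 a).
  by under eq_fun do rewrite !mxE; exact: measurable_funB.
pose c := `|f mu 0 a - m 0 a| + M.
have c0 : 0 <= c by rewrite addr_ge0// ltW.
apply: (integral_le_W (k := 4) (c := c ^+ 4) _ _ _ _).1 => //.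
- exact: measurable_funX.
- exact: exprn_ge0.
move=> w; rewrite normrX -exprMn lerXn2r ?nnegrE ?mulr_ge0// !mxE.
have -> : Y w 0 a - m 0 a = (Y w 0 a - f mu 0 a) + (f mu 0 a - m 0 a) by ring.
rewrite (le_trans (ler_normD _ _))// addrC mulrDl lerD//.
  by rewrite ler_peMr.
rewrite (le_trans (taylor1 a w))//.
by rewrite -mulrA ler_wpM2l ?(ltW M0)// (le_trans _ (NW w))// ler_piMl.
Qed.

Let LY a : L1 P (fun w => Y w 0 a).
Proof. exact: L1_coord (delta_finite_moment4 0) a. Qed.

Let LL a : L1 P (L a).
Proof.
apply: (integral_le_W (k := 1) (c := M) _ _ _ _).1 => // [|w]; first exact: ltW.
by rewrite expr1 (le_trans (L_le a w))// ler_wpM2l// ltW.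
Qed.

Let NWk w k : N w ^+ k <= W w ^+ k.
Proof. by rewrite lerXn2r ?nnegrE. Qed.

(** The linear term [e * L a] has mean 0, so it can be subtracted for free, which leaves a Taylor
    remainder of order 2. *)
Lemma delta_mean1 a :
  `|\int[P]_w (Y w 0 a) - f mu 0 a| <= M * e ^+ 2 * growth4 P xi.
Proof.
have LeL : L1 P (fun w => e * L a w) by exact: L1Z.
have LYf : L1 P (fun w => Y w 0 a - f mu 0 a) by apply: L1B => //; exact: L1_cst.
have -> : \int[P]_w (Y w 0 a) - f mu 0 a =
    \int[P]_w (Y w 0 a - f mu 0 a - e * L a w).
  rewrite RintegralB// RintegralB//; last exact: L1_cst.
  by rewrite Rint_cst RintegralZl// integral_L mulr0 subr0.
have Me : 0 <= M * e ^+ 2 by rewrite mulr_ge0 ?exprn_ge0 ?ltW.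
apply: (integral_le_W (k := 2) _ _ Me _).2 => // [|w].
  by apply: (@L1_measurable _ _ _ P); exact: L1B.
by rewrite (le_trans (taylor2 a w))// ler_wpM2l.
Qed.

(** One more Taylor term than in [delta_mean1]: it isolates the second-order mean correction up to
    [O(e ^+ 3)]. *)
Lemma delta_mean2 a :
  `|\int[P]_w (Y w 0 a) - f mu 0 a - e ^+ 2 * \int[P]_w (2^-1 *
      nderive (fun x => f x 0 a) [:: xi w; xi w] mu)| <= M * e ^+ 3 * growth4 P xi.
Proof.
have LQ : L1 P (fun w => 2^-1 * Q a w).
  apply: L1Z; apply: (integral_le_W (k := 2) (c := M) _ _ _ _).1 => // [|w].
    exact: ltW.
  by rewrite (le_trans (Q_le a w))// ler_wpM2l// ltW.
have LeL : L1 P (fun w => e * L a w) by exact: L1Z.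
have LeQ : L1 P (fun w => e ^+ 2 * (2^-1 * Q a w)) by exact: L1Z.
have LYf : L1 P (fun w => Y w 0 a - f mu 0 a) by apply: L1B => //; exact: L1_cst.
have LYL : L1 P (fun w => Y w 0 a - f mu 0 a - e * L a w) by exact: L1B.
rewrite -[X in _ - e ^+ 2 * X]/(\int[P]_w (2^-1 * Q a w)).
have -> : \int[P]_w (Y w 0 a) - f mu 0 a - e ^+ 2 * \int[P]_w (2^-1 * Q a w) =
    \int[P]_w (Y w 0 a - f mu 0 a - e * L a w - e ^+ 2 * (2^-1 * Q a w)).
  rewrite RintegralB// RintegralB// RintegralB//; last exact: L1_cst.
  rewrite Rint_cst RintegralZl// integral_L mulr0 subr0.
  by rewrite RintegralZl.
have Me : 0 <= M * e ^+ 3 by rewrite mulr_ge0 ?exprn_ge0 ?ltW.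
apply: (integral_le_W (k := 3) _ _ Me _).2 => // [|w].
  by apply: (@L1_measurable _ _ _ P); exact: L1B.
by rewrite (le_trans (taylor3 a w))// ler_wpM2l.
Qed.

Let integral_l1norm_le (m : 'rV[R]_d) (c : R) (k : nat) :
  0 <= c -> (k <= 4)%N -> (forall a w, `|(Y w - m) 0 a| <= c * W w) ->
  \int[P]_w (l1norm (Y w - m) ^+ k) <= (d%:R * c) ^+ k * K.
Proof.
move=> c0 k4 Yc.
have dc0 : 0 <= (d%:R * c) ^+ k by rewrite exprn_ge0// mulr_ge0.
apply: (le_trans (ler_norm _)).
apply: (integral_le_W (k := k) _ k4 dc0 _).2 => [|w].
  apply: measurable_funX; apply: measurable_l1norm.
  exact: delta_finite_moment4.
rewrite ger0_norm ?exprn_ge0 ?l1norm_ge0// -exprMn.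
rewrite lerXn2r ?nnegrE ?l1norm_ge0 ?mulr_ge0//.
rewrite /l1norm (le_trans (ler_sum _ (fun a _ => Yc a w)))//.
by rewrite sumr_const card_ord -[X in X <= _]mulr_natl mulrA.
Qed.

Lemma delta_second_moment :
  \int[P]_w (l1norm (Y w - f mu) ^+ 2) <= (d%:R * (M * e)) ^+ 2 * growth4 P xi.
Proof.
have Me : 0 <= M * e by rewrite mulr_ge0// ltW.
apply: integral_l1norm_le => // a w; rewrite !mxE.
by rewrite (le_trans (taylor1 a w))// ler_wpM2l.
Qed.

Let m := mean_vec P Y.
(** [M] comes from the Taylor remainder, and [M * K] from moving the centre from [f mu] to the mean
    of [Y] by means of [delta_mean1]. *)
Let B := M * (1 + K).

Let B0 : 0 < B. Proof. by rewrite mulr_gt0// ltr_pwDl. Qed.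

Let mE a : m 0 a = \int[P]_w (Y w 0 a). Proof. exact: mean_vecE. Qed.

Let zE a w : (Y w - m) 0 a = Y w 0 a - m 0 a.
Proof. by rewrite mxE [X in _ + X]mxE. Qed.

Let e2e : e ^+ 2 <= e. Proof. by rewrite expr2 ler_piMl// ltW. Qed.

Let W_expr_ge1 w k : 1 <= W w ^+ k.
Proof. exact: exprn_ege1. Qed.

Let Ym_le a w : `|(Y w - m) 0 a| <= B * e * W w.
Proof.
rewrite zE.
have -> : Y w 0 a - m 0 a = (Y w 0 a - f mu 0 a) - (m 0 a - f mu 0 a) by ring.
rewrite (le_trans (ler_normB _ _))//.
have -> : B * e * W w = M * e * W w + M * e * K * W w by rewrite /B; ring.
have Me : 0 <= M * e by rewrite mulr_ge0// ltW.
rewrite lerD//; first by rewrite (le_trans (taylor1 a w))// ler_wpM2l.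
rewrite mE (le_trans (delta_mean1 a))// (@le_trans _ _ (M * e * K))//.
  by rewrite ler_wpM2r// ler_wpM2l// ltW.
by rewrite ler_peMr// mulr_ge0.
Qed.

Let R_le a w : `|(Y w - m) 0 a - e * L a w| <= B * e ^+ 2 * W w ^+ 2.
Proof.
rewrite zE.
have -> : Y w 0 a - m 0 a - e * L a w =
  (Y w 0 a - f mu 0 a - e * L a w) - (m 0 a - f mu 0 a) by ring.
rewrite (le_trans (ler_normB _ _))//.
have -> : B * e ^+ 2 * W w ^+ 2 =
  M * e ^+ 2 * W w ^+ 2 + M * e ^+ 2 * K * W w ^+ 2 by rewrite /B; ring.
have Me : 0 <= M * e ^+ 2 by rewrite mulr_ge0 ?exprn_ge0 ?ltW.
rewrite lerD//; first by rewrite (le_trans (taylor2 a w))// ler_wpM2l.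
rewrite mE (le_trans (delta_mean1 a))//.
by rewrite ler_peMr// mulr_ge0.
Qed.

Let eL_le a w : `|e * L a w| <= B * e * W w.
Proof.
rewrite normrM gtr0_norm// (mulrC B) -mulrA ler_wpM2l ?(ltW e0)//.
rewrite (le_trans (L_le a w))// ler_pM ?(ltW M0)// /B ler_peMr ?(ltW M0)//.
by rewrite lerDl.
Qed.

Lemma delta_central4 :
  \int[P]_w (l1norm (Y w - mean_vec P Y) ^+ 4)
    <= (d%:R * (M * (1 + growth4 P xi) * e)) ^+ 4 * growth4 P xi.
Proof.
apply: integral_l1norm_le => //.
by rewrite mulr_ge0// ltW.
Qed.

(** Controls the diagonal of the covariance matrix of [Y], and through it the fourth moment of the
    moment-matched Gaussian. *)
Lemma delta_variance a :
  \int[P]_w (((Y w - mean_vec P Y) 0 a) ^+ 2)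
    <= (M * (1 + growth4 P xi) * e) ^+ 2 * growth4 P xi.
Proof.
apply: (le_trans (ler_norm _)).
have Be0 : 0 <= B * e by rewrite mulr_ge0// ltW.
have mz : measurable_fun setT (fun w => (Y w - m) 0 a).
  by under eq_fun do rewrite zE; exact: measurable_funB.
apply: (integral_le_W (k := 2) _ _ _ _).2 => //.
- exact: measurable_funX.
- exact: exprn_ge0.
by move=> w; rewrite normrX -exprMn lerXn2r ?nnegrE//; exact: mulr_ge0.
Qed.

(* [Y - E Y = e L + O(e ^+ 2)], and the odd moment of the Gaussian [L]
   vanishes. *)
Lemma delta_third_moment i j k :
  `|\int[P]_w monom (Y w - mean_vec P Y) [:: i; j; k]|
    <= 3 * (M * (1 + growth4 P xi)) ^+ 3 * e ^+ 4 * growth4 P xi.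
Proof.
rewrite -/m -/K -/B.
pose z a w := (Y w - m) 0 a.
have Lm : L1 P (fun w => monom (Y w - m) [:: i; j; k]).
  by apply: L1_monom => //; exact: delta_finite_moment4.
pose LLL w := L i w * (L j w * L k w).
have LLLL : L1 P LLL.
  apply: (integral_le_W (k := 3) (c := M ^+ 3) _ _ _ _).1 => //.
  - by do ?apply: measurable_funM.
  - by rewrite exprn_ge0// ltW.
  have LW a w : `|L a w| <= M * W w.
    by rewrite (le_trans (L_le a w))// ler_wpM2l// ltW.
  move=> w; rewrite /LLL !normrM.
  have -> : M ^+ 3 * W w ^+ 3 = (M * W w) * ((M * W w) * (M * W w)) by ring.
  by rewrite !ler_pM// ?mulr_ge0.
have Le : L1 P (fun w => e ^+ 3 * LLL w) by exact: L1Z.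
have -> : \int[P]_w monom (Y w - m) [:: i; j; k] =
    \int[P]_w (monom (Y w - m) [:: i; j; k] - e ^+ 3 * LLL w).
  by rewrite RintegralB// RintegralZl// integral_LLL mulr0 subr0.
have c0 : 0 <= 3 * B ^+ 3 * e ^+ 4.
  by apply: mulr_ge0; [apply: mulr_ge0; [exact: ler0n|]|]; exact/exprn_ge0/ltW.
apply: (integral_le_W (k := 4) _ _ c0 _).2 => // [|w].
  by apply: (@L1_measurable _ _ _ P); exact: L1B.
(* Telescoping: the factors [z] are replaced by [e * L] one at a time. Each of the three terms has
   one factor [O(e ^+ 2)] and two factors [O(e)], whence [3] and [e ^+ 4]. *)
have -> : monom (Y w - m) [:: i; j; k] - e ^+ 3 * LLL w =
    (z i w - e * L i w) * (z j w * z k w) +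
    (e * L i w) * ((z j w - e * L j w) * z k w) +
    (e * L i w) * (e * L j w) * (z k w - e * L k w).
  by rewrite /monom !big_cons big_nil /LLL /z; ring.
have -> : 3 * B ^+ 3 * e ^+ 4 * W w ^+ 4 =
    (B * e ^+ 2 * W w ^+ 2) * ((B * e * W w) * (B * e * W w)) +
    (B * e * W w) * ((B * e ^+ 2 * W w ^+ 2) * (B * e * W w)) +
    (B * e * W w) * (B * e * W w) * (B * e ^+ 2 * W w ^+ 2) by ring.
move: (eL_le i w) (eL_le j w) (R_le i w) (R_le j w) (R_le k w).
move: (Ym_le j w) (Ym_le k w); rewrite -/(z i w) -/(z j w) -/(z k w).
move: (z k w - _) (z j w - _) (z i w - _) => r3 r2 r1.
move: (e * L i w) (e * L j w) (z j w) (z k w) => l1 l2 z2 z3.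
move: (B * e * W w) (B * e ^+ 2 * W w ^+ 2) => x y.
move=> z2x z3x l1x l2x r1y r2y r3y.
apply: (le_trans (ler_normD _ _)); apply: lerD.
  apply: (le_trans (ler_normD _ _)); apply: lerD.
all: by rewrite !normrM !ler_pM// ?mulr_ge0.
Qed.

End delta_method.

(** * Coordinate functions as test functions and the lower bound on [d4] *)

Section linear_test_function.
Context (R : realType) (d : nat).

Lemma nderive_cst (c : R) (v : 'rV[R]_d) (vs : seq 'rV[R]_d) :
  nderive (cst c) (v :: vs) = cst 0.
Proof.
elim: vs v => [|u vs IH] v.
  by apply/funext => x; rewrite /nderive /= derive_cst.
rewrite -[LHS]/('D_v (nderive (cst c) (u :: vs))) IH.
by apply/funext => x; rewrite derive_cst.
Qed.

Lemma times_differentiable_cst k (c : R) :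
  times_differentiable k (cst c : 'rV[R]_d -> R).
Proof.
elim: k c => //= k IH c; split=> [x|v]; first exact: differentiable_cst.
rewrite (_ : 'D_v (cst c) = cst 0)//.
by apply/funext => x; rewrite derive_cst.
Qed.

Lemma derive_coord (a : 'I_d) (v : 'rV[R]_d) :
  'D_v (fun x : 'rV[R]_d => x 0 a) = cst (v 0 a).
Proof.
have di : times_differentiable 1 (@id 'rV[R]_d).
  by split=> // x; exact: ex_diff.
have /= -> := @nderive_coord R d d id a 1 [:: v] di isT.
by apply/funext => x; rewrite derive_id.
Qed.

(** The first derivative is [v |-> v 0 a], of operator norm at most 1, and all higher ones
    vanish. *)
Lemma sobolev4_coord (a : 'I_d) :
  (sobolev4 (fun x : 'rV[R]_d => (x 0 a)%R) <= 1)%E.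
Proof.
rewrite /sobolev4 big_nat.
apply: (big_ind (fun x => (x <= 1)%E)) => [|x y x1 y1|j /andP[j1 _]].
- by rewrite lee_fin.
- by rewrite ge_max x1.
apply: ge_ereal_sup => _ [x _ <-]; apply: ge_ereal_sup => _ [t /= t1 <-].
have {}t1 v : v \in tval t -> enorm v <= 1 by move=> /tnthP[i ->].
(* The last direction is differentiated first and already leaves a constant function. *)
rewrite lee_fin; case/lastP: (tval t) (size_tuple t) t1 => [|vs v] sz t1.
  by rewrite -sz in j1.
rewrite /nderive foldr_rcons derive_coord -/(nderive _ _).
case: vs sz t1 => [|u vs] sz t1; last by rewrite nderive_cst /= normr0.
by rewrite (le_trans (coord_le_enorm _ _))// t1 ?mem_head.
Qed.

End linear_test_function.

Lemma d4_ge_mean (R : realType) (n : nat)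
    (dT : measure_display) (T : measurableType dT) (P : probability T R)
    (U : T -> 'rV[R]_n)
    (dT' : measure_display) (T' : measurableType dT') (Q : probability T' R)
    (V : T' -> 'rV[R]_n) (m : 'rV[R]_n) (a : 'I_n) :
  finite_moment4 P U m -> finite_moment4 Q V m ->
  ((`|\int[P]_w U w 0 a - \int[Q]_w V w 0 a|%R)%:E <= d4 P U Q V)%E.
Proof.
move=> U4 V4; pose h (x : 'rV[R]_n) := x 0 a.
have dh : times_differentiable 4 h.
  split=> [x|v]; first exact: differentiable_coord.
  by rewrite /h derive_coord; exact: times_differentiable_cst.
have h1 := sobolev4_coord R a.
have hp := bounded_partials_sobolev4 dh h1.
apply: ereal_sup_ubound; exists h => //.
have LP := L1_bounded_partials U4 hp.
have LQ := L1_bounded_partials V4 hp.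
rewrite unlock -(fineK (integrable_fin_num _ LP))// -(fineK (integrable_fin_num _ LQ))//.
Qed.

(** * Mean and covariance as integrals, and the four asymptotic claims *)

Lemma cov_mxE (R : realType) (d : nat) (dT : measure_display)
    (T : measurableType dT) (P : probability T R) (Z : T -> 'rV[R]_d) i j :
  cov_mx P Z i j = \int[P]_w monom (Z w - mean_vec P Z) [:: i; j].
Proof.
rewrite mxE unlock /Rintegral; congr fine.
rewrite unlock; apply: eq_integral => w _; congr EFin.
by rewrite /monom big_cons big_seq1 !mxE unlock.
Qed.

Lemma gaussian_mean (R : realType) (n : nat) (dT : measure_display)
    (T : measurableType dT) (P : probability T R) (Z : T -> 'rV[R]_n)
    (m : 'rV[R]_n) (S : 'M[R]_n) i :
  gaussian_vector P Z m S -> \int[P]_w Z w 0 i = m 0 i.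
Proof.
move=> gZ; apply/subr0_eq.
by rewrite -(integral_monom1 (gaussian_finite_moment4 gZ)) (gaussian_monom1 gZ).
Qed.

(** The informal genericity is the condition [b != 0], under which the linearized error is of exact
    order [l ^- 2]. The constants do not depend on the probability space that carries the
    Gaussian. *)
Theorem theorem4p2 (R : realType) (n d : nat)
    (mu : 'rV[R]_n) (Sigma : 'M[R]_n) (f : 'rV[R]_n -> 'rV[R]_d)
    (dT : measure_display) (T : measurableType dT) (P : probability T R)
    (xi : T -> 'rV[R]_n)
    (xi_gauss : gaussian_vector P xi 0 Sigma)
    (f_diff : times_differentiable 4 f)
    (f_bounded : forall j : nat, (1 <= j <= 4)%N ->
       (sup_deriv_norm (@enorm R d) j f < +oo)%E) :
  let X (l : R) (w : T) := mu + l^-1 *: xi w in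
  let Y (l : R) (w : T) := f (X l w) in
  let J := Jac f mu in
  (* l ^- 2 *: b is the second-order mean correction *)
  let b := mean_vec P (fun w => 2^-1 *: nderive f [:: xi w; xi w] mu) in
  [/\ exists C : R, \forall l \near +oo,
        forall (dG : measure_display) (TG : measurableType dG)
          (PG : probability TG R) (gY : TG -> 'rV[R]_d),
        gaussian_vector PG gY (mean_vec P (Y l)) (cov_mx P (Y l)) ->
        (d4 P (Y l) PG gY <= (C * l ^- 4)%:E)%E,
      exists C : R, \forall l \near +oo,
        forall (dG : measure_display) (TG : measurableType dG)
          (PG : probability TG R) (Glin : TG -> 'rV[R]_d),
        gaussian_vector PG Glin (f mu) (l ^- 2 *: (J *m Sigma *m J^T)) ->
        (d4 P (Y l) PG Glin <= (C * l ^- 2)%:E)%E,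
      l ^+ 2 *: (mean_vec P (Y l) - f mu) @[l --> +oo] --> b &
      b != 0 ->
      exists2 c : R, 0 < c & \forall l \near +oo,
        forall (dG : measure_display) (TG : measurableType dG)
          (PG : probability TG R) (Glin : TG -> 'rV[R]_d),
        gaussian_vector PG Glin (f mu) (l ^- 2 *: (J *m Sigma *m J^T)) ->
        ((c * l ^- 2)%:E <= d4 P (Y l) PG Glin)%E].
Proof.
move=> X Y J b.
have [M M0 fM] := bounded_partials_coord f_diff f_bounded.
set K := growth4 P xi.
have K0 : 0 <= K.
  by apply: Rintegral_ge0 => w _; rewrite exprn_ge0// addr_ge0// l1norm_ge0.
have l01 (l : R) : 1 <= l -> 0 < l^-1 <= 1.
  move=> l1; have l0 : 0 < l by exact: lt_le_trans l1.
  by rewrite invr_gt0 l0 invf_le1.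
have mY1 l a : 1 <= l -> `|mean_vec P (Y l) 0 a - f mu 0 a| <= M * l^-1 ^+ 2 * K.
  by move=> l1; rewrite mean_vecE; exact: (delta_mean1 mu xi_gauss M0 fM (l01 _ l1)).
have mY2 l a : 1 <= l ->
    `|mean_vec P (Y l) 0 a - f mu 0 a - l^-1 ^+ 2 * b 0 a| <= M * l^-1 ^+ 3 * K.
  move=> l1; rewrite !mean_vecE.
  have := delta_mean2 mu xi_gauss M0 fM (l01 _ l1) a; apply: le_trans.
  rewrite le_eqVlt; apply/orP; left; apply/eqP; congr (`|_ - _ * _|).
  apply: eq_Rintegral => w _; rewrite mxE.
  by rewrite (nderive_coord a (vs := [:: xi w; xi w]) f_diff).
have Y4 l m : 1 <= l -> finite_moment4 P (Y l) m.
  by move=> l1; exact: (delta_finite_moment4 mu xi_gauss M0 fM (l01 _ l1)).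
split.
- pose B := M * (1 + K).
  (* The three summands bound the fourth central moment of [Y], that of the Gaussian, and the third
     moments of [Y]. *)
  exists ((d%:R * B) ^+ 4 * K + d%:R ^+ 4 * (48 * expR 1 * (B ^+ 2 * (1 + K)) ^+ 2)
    + (size (words d 3))%:R * (3 * B ^+ 3 * K)).
  near=> l => dG TG PG gY ggY.
  have l1 : 1 <= l by near: l; exact: nbhs_pinfty_ge.
  have e01 := l01 l l1; set e := l^-1 in e01.
  have /andP[e0 _] := e01.
  have Y4m := Y4 l (mean_vec P (Y l)) l1.
  apply: (le_trans (d4_le_moments Y4m (gaussian_finite_moment4 ggY) (k := 4) isT)).
  rewrite lee_fin.
  (* [1 + K] replaces [K] because [gaussian_l1norm_expr4] asks for a strictly positive variance
     bound. *)
  have s0 : 0 < (B * e) ^+ 2 * (1 + K).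
    by rewrite mulr_gt0 ?exprn_gt0 ?mulr_gt0 ?ltr_pwDl.
  have Ss i : cov_mx P (Y l) i i <= (B * e) ^+ 2 * (1 + K).
    rewrite cov_mxE.
    have := delta_variance mu xi_gauss M0 fM e01 i; rewrite -/K -/B => H.
    apply: (@le_trans _ _ ((B * e) ^+ 2 * K)); last first.
      by rewrite ler_wpM2l ?sqr_ge0// lerDr.
    apply: le_trans H; rewrite le_eqVlt; apply/orP; left; apply/eqP.
    by apply: eq_Rintegral => w _; rewrite /monom big_cons big_seq1 -expr2.
  have H4 := delta_central4 mu xi_gauss M0 fM e01; rewrite -/K -/B in H4.
  have G4 := gaussian_l1norm_expr4 ggY s0 Ss.
  rewrite big_ltn// big_ltn// big_ltn// big_geq// addr0.
  (* Moment matching: orders 1 and 2 contribute exactly 0. *)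
  have W1 : \sum_(J <- words d 1)
      `|\int[P]_w monom (Y l w - mean_vec P (Y l)) J -
        \int[PG]_w monom (gY w - mean_vec P (Y l)) J| <= (size (words d 1))%:R * 0.
    apply: ler_sum_words => -[|i []]// _; rewrite (gaussian_monom1 ggY) subr0.
    by rewrite (integral_monom1 Y4m) -mean_vecE subrr normr0.
  have W2 : \sum_(J <- words d 2)
      `|\int[P]_w monom (Y l w - mean_vec P (Y l)) J -
        \int[PG]_w monom (gY w - mean_vec P (Y l)) J| <= (size (words d 2))%:R * 0.
    apply: ler_sum_words => -[|i [|j []]]// _.
    by rewrite (gaussian_monom2 ggY) cov_mxE subrr normr0.
  have W3 : \sum_(J <- words d 3)
      `|\int[P]_w monom (Y l w - mean_vec P (Y l)) J -
        \int[PG]_w monom (gY w - mean_vec P (Y l)) J|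
      <= (size (words d 3))%:R * (3 * B ^+ 3 * e ^+ 4 * K).
    apply: ler_sum_words => -[|i [|j [|k []]]]// _.
    rewrite (gaussian_monom3 ggY) subr0.
    exact: (delta_third_moment mu xi_gauss M0 fM e01).
  rewrite mulr0 in W1 W2.
  have := lerD (lerD H4 G4) (lerD W1 (lerD W2 W3)); rewrite !add0r.
  move/le_trans; apply.
  rewrite -exprVn -/e le_eqVlt; apply/orP; left; apply/eqP; ring.
(* With [k = 2] at [f mu], the second moments are not compared but only bounded, each being
   [O(l ^- 2)]; the last summand is the shift of the mean. *)
- exists ((d%:R * M) ^+ 2 * K + d%:R * \sum_i (J *m Sigma *m J^T) i i
    + (size (words d 1))%:R * (M * K)).
  near=> l => dG TG PG Glin gG.
  have l1 : 1 <= l by near: l; exact: nbhs_pinfty_ge.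
  have e01 := l01 l l1; set e := l^-1 in e01.
  apply: (le_trans (d4_le_moments (Y4 l (f mu) l1)
    (gaussian_finite_moment4 gG) (k := 2) isT)).
  rewrite lee_fin big_ltn// big_geq// addr0.
  have H2 := delta_second_moment mu xi_gauss M0 fM e01; rewrite -/K in H2.
  have G2 := gaussian_l1norm_sqr gG.
  have W1 : \sum_(J <- words d 1)
      `|\int[P]_w monom (Y l w - f mu) J - \int[PG]_w monom (Glin w - f mu) J|
      <= (size (words d 1))%:R * (M * e ^+ 2 * K).
    apply: ler_sum_words => -[|i []]// _; rewrite (gaussian_monom1 gG) subr0.
    by rewrite (integral_monom1 (Y4 l (f mu) l1)) -mean_vecE mY1.
  have := lerD (lerD H2 G2) W1; move/le_trans; apply.
  rewrite -exprVn -/e.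
  under eq_bigr do rewrite mxE.
  rewrite -mulr_sumr le_eqVlt; apply/orP; left; apply/eqP; ring.
- apply/cvg_ballP => eps eps0; near=> l; split=> // i a; rewrite ord1.
  have l1 : 1 <= l by near: l; exact: nbhs_pinfty_ge.
  have l0 : 0 < l by exact: lt_le_trans l1.
  (* After scaling by [l ^+ 2] the error in the mean is at most [M * K / l], which is then below
     [eps]. *)
  have MKl : M * K / eps < l.
    by near: l; apply: nbhs_pinfty_gt; exact: num_real.
  have -> : (l ^+ 2 *: (mean_vec P (Y l) - f mu)) 0 a =
      l ^+ 2 * (mean_vec P (Y l) 0 a - f mu 0 a).
    by rewrite mxE; congr (_ * _); rewrite mxE [X in _ + X]mxE.
  rewrite /ball /= /ball_ distrC.
  have -> : l ^+ 2 * (mean_vec P (Y l) 0 a - f mu 0 a) - b 0 a =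
      l ^+ 2 * (mean_vec P (Y l) 0 a - f mu 0 a - l^-1 ^+ 2 * b 0 a).
    by field; rewrite gt_eqF.
  rewrite normrM ger0_norm ?sqr_ge0//.
  apply: (@le_lt_trans _ _ (l ^+ 2 * (M * l^-1 ^+ 3 * K))).
    by rewrite ler_wpM2l ?sqr_ge0// mY2.
  have -> : l ^+ 2 * (M * l^-1 ^+ 3 * K) = M * K / l by field; rewrite gt_eqF.
  by rewrite ltr_pdivrMr// [eps * l]mulrC -ltr_pdivrMr.
- move=> b0.
  have [a ba] : exists a, b 0 a != 0.
    apply/existsP; apply: contraNT b0; rewrite negb_exists => /forallP H.
    by apply/eqP/rowP => i; rewrite [RHS]mxE; apply/eqP/negPn/H.
  have ba0 : 0 < `|b 0 a| by rewrite normr_gt0.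
  (* For large [l] the cubic error takes up at most half of the correction in coordinate [a]; the
     other half remains. *)
  exists (`|b 0 a| / 2); first by rewrite divr_gt0.
  near=> l => dG TG PG Glin gG.
  have l1 : 1 <= l by near: l; exact: nbhs_pinfty_ge.
  have l0 : 0 < l by exact: lt_le_trans l1.
  have e0 : 0 < l^-1 by rewrite invr_gt0.
  have MKl : 2 * (M * K) / `|b 0 a| <= l.
    by near: l; apply: nbhs_pinfty_ge; exact: num_real.
  have MKe : M * K * l^-1 <= `|b 0 a| / 2.
    rewrite ler_pdivrMr// in MKl.
    by rewrite ler_pdivlMr// mulrAC ler_pdivrMr// mulrC [leRHS]mulrC.
  apply: le_trans (d4_ge_mean a (Y4 l (f mu) l1) (gaussian_finite_moment4 gG)).
  rewrite lee_fin (gaussian_mean a gG) -mean_vecE -exprVn.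
  have := mY2 l a l1; set D := mean_vec P (Y l) 0 a - f mu 0 a; set e := l^-1 => H.
  have e2 : 0 < e ^+ 2 by rewrite exprn_gt0.
  have : `|e ^+ 2 * b 0 a| <= `|D| + M * e ^+ 3 * K.
    have -> : e ^+ 2 * b 0 a = D - (D - e ^+ 2 * b 0 a) by ring.
    by rewrite (le_trans (ler_normB _ _))// lerD2l.
  rewrite normrM (gtr0_norm e2) -lerBlDr; apply: le_trans.
  have : e ^+ 2 * (M * K * e) <= e ^+ 2 * (`|b 0 a| / 2) by rewrite ler_pM2l.
  have -> : M * e ^+ 3 * K = e ^+ 2 * (M * K * e) by ring.
  move=> H2; rewrite lerBrDl -lerBrDr (le_trans H2)// le_eqVlt.
  by apply/orP; left; apply/eqP; field.
Unshelve. all: by end_near.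
Qed.
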